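(* Let $k\in\mathbb{N}_0$, $\alpha\in\mathbb{C}$, and let $\beta,\gamma>-1$ be real numbers such that if $\beta,\gamma\in(-1,0)$ then $\beta+\gamma+1\neq0$. Let $\rho\in\{z\in\mathbb{C}:|z|<1\}$. Then $$\int_{-1}^1(1-x)^{\gamma-\alpha/2}(1+x)^{\beta/2}J_\alpha\!\left(\sqrt{2(1-x)\rho}\right)I_\beta\!\left(\sqrt{2(1+x)\rho}\right)P_k^{(\gamma,\beta)}(x)\,dx$$ $$=\frac{2^{\gamma+\beta/2-\alpha/2+1}\,\Gamma(\gamma+k+1)\left(\frac{\alpha+\beta+1}{2}\right)_k\left(\frac{\alpha+\beta+2}{2}\right)_k}{\Gamma(\gamma+\beta+2)\,\Gamma(\alpha+k+1)\,(\alpha+\beta+1)_k\left(\frac{\gamma+\beta+2}{2}\right)_k\left(\frac{\gamma+\beta+3}{2}\right)_k\,k!}\;{}_2F_3\!\left(\begin{array}{c}2k+\alpha+\beta+1,\ \alpha-\gamma\\ \alpha+\beta+k+1,\ \gamma+\beta+2k+2,\ \alpha+1+k\end{array};\rho\right)\rho^{\alpha/2+\beta/2+k}.$$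
   Context: $\mathbb{N}_0=\{0,1,2,\dots\}$. Square roots and complex powers are principal. $(z)_n:=\prod_{i=1}^n(z+i-1)$ is the Pochhammer symbol. ${}_pF_q(a_1,\dots,a_p;b_1,\dots,b_q;z):=\sum_{n=0}^\infty\frac{(a_1)_n\cdots(a_p)_n}{(b_1)_n\cdots(b_q)_n}\frac{z^n}{n!}$. The Jacobi polynomials are $P_n^{(\alpha,\beta)}(z):=\frac{(\alpha+1)_n}{n!}\,{}_2F_1\left(-n,n+\alpha+\beta+1;\alpha+1;\frac{1-z}{2}\right)$. The Bessel function of the first kind and modified Bessel function of the first kind are $J_\nu(z):=\frac{(z/2)^\nu}{\Gamma(\nu+1)}\,{}_0F_1\left(-;\nu+1;-\frac{z^2}{4}\right)$ and $I_\nu(z):=\frac{(z/2)^\nu}{\Gamma(\nu+1)}\,{}_0F_1\left(-;\nu+1;\frac{z^2}{4}\right)$, where $1/\Gamma(\nu+1)$ is absorbed into the series (as $\sum_n\frac{(\mp1)^n(z/2)^{2n+\nu}}{n!\,\Gamma(\nu+n+1)}$, upper sign for $J_\nu$, lower for $I_\nu$) when $\nu$ is a negative integer. Interpretation: at $\rho=0$ the identity is understood after dividing both sides by $\rho^{\alpha/2+\beta/2}$ and letting $\rho\to0$. If $\alpha+1$ or $\alpha+\beta+1$ lies in $\{0,-1,-2,\dots\}$, the product $\frac{\left(\frac{\alpha+\beta+1}{2}\right)_k\left(\frac{\alpha+\beta+2}{2}\right)_k}{\Gamma(\alpha+k+1)(\alpha+\beta+1)_k}\,{}_2F_3(\cdots;\rho)$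 is understood as its analytic continuation in $\alpha$, namely $4^{-k}\sum_{n=0}^\infty\frac{(\alpha-\gamma)_n(\alpha+\beta+k+n+1)_k}{(\gamma+\beta+2k+2)_n\,\Gamma(\alpha+k+n+1)}\frac{\rho^n}{n!}$ with $1/\Gamma$ entire. *)

(* Defs.v *)
From HB Require Import structures.
From mathcomp Require Import all_boot all_order all_algebra.
From mathcomp Require Import all_classical all_reals all_analysis.
From mathcomp Require Import complex.

Set Implicit Arguments.
Unset Strict Implicit.
Unset Printing Implicit Defensive.

Import Order.TTheory GRing.Theory Num.Theory.
Import numFieldNormedType.Exports.

Local Open Scope classical_set_scope.
Local Open Scope ring_scope.
Local Open Scope complex_scope.

Section ComplexAnalysis.
Variable R : realType.
Local Notation C := R[i].
Implicit Types (z w nu a b : C) (n : nat).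

(* The topology of the complex numbers is only inferred on the alias R[i]^o. *)
Definition Clim (u : nat -> C) : C := limn (u : nat -> C^o).
Definition Cseries (u : nat -> C) : C := Clim (series u).

Definition Cexp z : C :=
  (expR (complex.Re z) * cos (complex.Im z)) +i*
  (expR (complex.Re z) * sin (complex.Im z)).

(* Principal argument, with values in ]-pi, pi] for z != 0. *)
Definition Carg z : R :=
  let t := acos (complex.Re z / ComplexField.Normc.normc z) in
  if 0 <= complex.Im z then t else - t.

Definition Clog z : C := ln (ComplexField.Normc.normc z) +i* Carg z.

(* Principal power w ^ z.  The principal square root is the library's sqrtc
   (nonnegative real part), not sqrtC, whose values have nonnegative
   imaginary part. *)
Definition Cpow w z : C := if w == 0 then (z == 0)%:R else Cexp (z * Clog w).

Definition pochhammer z n : C := \prod_(i < n) (z + i%:R).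

(* The entire function 1/Gamma, by the Euler-Gauss limit
   Gamma(z) = lim_n n! n^z / (z (z + 1) ... (z + n)). *)
Definition rGamma z : C :=
  Clim (fun n => (\prod_(i < n.+1) (z + i%:R)) / (n`!%:R * Cpow n%:R z)).

Definition Gamma z : C := (rGamma z)^-1.

Definition pFq (s t : seq C) z : C :=
  Cseries (fun n => (\prod_(a <- s) pochhammer a n)
                    / (\prod_(b <- t) pochhammer b n) * (z ^+ n / n`!%:R)).

Definition jacobi n a b z : C :=
  pochhammer (a + 1) n / n`!%:R
  * pFq [:: - n%:R; n%:R + a + b + 1] [:: a + 1] ((1 - z) / 2%:R).

Definition nonpos_integer z : Prop := exists m : nat, z = - m%:R.

(* Common form of J_nu (sgn = -1) and I_nu (sgn = 1); when nu is a negative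
   integer, 1/Gamma(nu + 1) is absorbed into the series. *)
Definition bessel (sgn : C) nu z : C :=
  if `[< exists m : nat, nu = - m.+1%:R >] then
    Cseries (fun n => sgn ^+ n * Cpow (z / 2%:R) (2%:R * n%:R + nu)
                      / n`!%:R * rGamma (nu + n%:R + 1))
  else
    Cpow (z / 2%:R) nu / Gamma (nu + 1)
    * pFq [::] [:: nu + 1] (sgn * (z ^+ 2 / 4%:R)).

Definition besselJ := bessel (- 1).
Definition besselI := bessel 1.

Definition Cintegrable (D : set R) (f : R -> C) : Prop :=
  lebesgue_measure.-integrable D (fun x => (complex.Re (f x))%:E) /\
  lebesgue_measure.-integrable D (fun x => (complex.Im (f x))%:E).

Definition Cintegral (D : set R) (f : R -> C) : C :=
  (\int[lebesgue_measure]_(x in D) complex.Re (f x)) +i*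
  (\int[lebesgue_measure]_(x in D) complex.Im (f x)).

Section BesselJacobi.
Variables (k : nat) (alpha : C) (beta gamma : R).
Local Notation be := (beta%:C).
Local Notation ga := (gamma%:C).

Definition bessel_jacobi_integrand (rho : C) (x : R) : C :=
  Cpow (1 - x)%:C (ga - alpha / 2%:R)
  * Cpow (1 + x)%:C (be / 2%:R)
  * besselJ alpha (sqrtc (2%:R * (1 - x)%:C * rho))
  * besselI be (sqrtc (2%:R * (1 + x)%:C * rho))
  * jacobi k ga be x%:C.

Definition bessel_jacobi_integral (rho : C) : C :=
  Cintegral `]-1, 1[ (bessel_jacobi_integrand rho).

(* The alpha-dependent Gamma and Pochhammer factors times the 2F3, replaced by
   its analytic continuation in alpha at the exceptional parameters. *)
Definition alpha_factor (rho : C) : C :=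
  if `[< nonpos_integer (alpha + 1) \/ nonpos_integer (alpha + be + 1) >] then
    4%:R ^- k
    * Cseries (fun n =>
        pochhammer (alpha - ga) n * pochhammer (alpha + be + k%:R + n%:R + 1) k
        / pochhammer (ga + be + 2%:R * k%:R + 2%:R) n
        * rGamma (alpha + k%:R + n%:R + 1) * (rho ^+ n / n`!%:R))
  else
    pochhammer ((alpha + be + 1) / 2%:R) k
    * pochhammer ((alpha + be + 2%:R) / 2%:R) k
    / (Gamma (alpha + k%:R + 1) * pochhammer (alpha + be + 1) k)
    * pFq [:: 2%:R * k%:R + alpha + be + 1; alpha - ga]
          [:: alpha + be + k%:R + 1; ga + be + 2%:R * k%:R + 2%:R;
              alpha + 1 + k%:R]
          rho.

Definition bessel_jacobi_value (rho : C) : C :=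
  Cpow 2%:R (ga + be / 2%:R - alpha / 2%:R + 1) * Gamma (ga + k%:R + 1)
  / (Gamma (ga + be + 2%:R)
     * pochhammer ((ga + be + 2%:R) / 2%:R) k
     * pochhammer ((ga + be + 3%:R) / 2%:R) k
     * k`!%:R)
  * alpha_factor rho
  * Cpow rho (alpha / 2%:R + be / 2%:R + k%:R).

End BesselJacobi.
End ComplexAnalysis.

(* Main.v *)
Require Import Defs.
From HB Require Import structures.
From mathcomp Require Import all_boot all_order all_algebra.
From mathcomp Require Import all_classical all_reals all_analysis.
From mathcomp Require Import measurable_realfun complex ring lra.
Import Order.TTheory GRing.Theory Num.Theory.
Import numFieldNormedType.Exports.
Local Open Scope classical_set_scope.
Local Open Scope ring_scope.
Local Open Scope complex_scope.

(** Write u = (1 - x) / 2 and v = (1 + x) / 2.  The powers of 1 - x and 1 + x in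
    the integrand cancel the branch factors of the two Bessel functions, because
    positive factors pass through principal powers and square roots
    (bessel_jacobi_integrandE).  What remains is a constant times a power of
    rho, times the Jacobi weight of parameters (gamma, beta), the Jacobi
    polynomial of degree k, and two entire functions of rho u and rho v.  Their
    Cauchy product (cauchy_product) is a power series in rho that can be
    integrated termwise by dominated convergence (integral_series), so the
    theorem is a formula for each moment, the coefficient of rho^N
    (expansion_momentE).

    A moment is a double sum of Euler beta integrals, over the index s of the
    Bessel product and the index j of the Jacobi polynomial.  The value
    2 Gamma(a) Gamma(b) / Gamma(a + b) of such an integral (beta_int_rGamma)
    cancels the 1/Gamma of the second Bessel series, so the sum over s is a
    Chu-Vandermonde sum (chu_vandermonde), and the remaining sum over j is
    balanced and is evaluated by pfaff_saalschutz.  The result vanishes for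
    N < k, which is orthogonality, and for N = k + n it is the n-th term of the
    right-hand side in its analytically continued form.  That form
    is the product with the 2F3 at nonexceptional parameters (alpha_factorE).

    Gamma is given by the Gauss product.  Its functional equation (rGammaS) is
    all that is needed at the complex parameter alpha, both for the convergence
    of the Bessel series and for the cancellation between its terms.  At the
    positive parameters coming from beta and gamma, convergence and positivity
    are also needed (gauss_prod_cvg), and they are what identifies the beta
    integral: integration by parts gives its recurrence, monotonicity in the
    second parameter squeezes it between explicit values at integers, and the
    limit of this comparison is the Gauss product.

    At rho = 0 both quotients agree off the origin, where they are z^k times a
    power series in z, so they have a common limit (power_series_cvg0). *)

Set Implicit Arguments.
Unset Strict Implicit.
Unset Printing Implicit Defensive.

(** * Pochhammer symbols and terminating hypergeometric sums *)
Section Hypergeometric.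
Context {R : realType}.
Local Notation C := R[i].
Implicit Types (a b d s z : C) (f : nat -> C).

Lemma pochhammer0 z : pochhammer z 0 = 1.
Proof. by rewrite /pochhammer big_ord0. Qed.

Lemma pochhammerS z n : pochhammer z n.+1 = pochhammer z n * (z + n%:R).
Proof. by rewrite /pochhammer big_ord_recr. Qed.

Lemma pochhammerSl z n : pochhammer z n.+1 = z * pochhammer (z + 1) n.
Proof.
rewrite /pochhammer big_ord_recl addr0; congr (_ * _).
by apply: eq_bigr => i _; rewrite lift0 -natr1; ring.
Qed.

Lemma pochhammerD z m n :
  pochhammer z (m + n) = pochhammer z m * pochhammer (z + m%:R) n.
Proof.
elim: n => [|n IH]; first by rewrite addn0 pochhammer0 mulr1.
by rewrite addnS !pochhammerS IH natrD; ring.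
Qed.

Lemma pochhammer_opp_nat k n :
  pochhammer (- k%:R : C) n = (-1) ^+ n * (k ^_ n)%:R.
Proof.
elim: n => [|n IH]; first by rewrite pochhammer0 ffactn0 mulr1.
rewrite pochhammerS IH ffactnSr natrM exprS.
have [nk|kn] := leqP n k; first by rewrite natrB//; ring.
by rewrite ffact_small// !mul0r !mulr0 mul0r.
Qed.

Lemma pochhammer_neq0 z n :
  (forall i, (i < n)%N -> z + i%:R != 0) -> pochhammer z n != 0.
Proof. by move=> h; apply/prodf_neq0 => i _; exact: h. Qed.

(** Legendre duplication for Pochhammer symbols: the two half-step products
    interleave into one unit-step product. *)
Lemma pochhammer_duplication z n :
  pochhammer (z / 2%:R) n * pochhammer ((z + 1) / 2%:R) n
  = 4%:R ^- n * pochhammer z (n + n).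
Proof.
elim: n => [|n IH]; first by rewrite !pochhammer0 expr0 invr1 !mulr1.
rewrite addSn addnS !pochhammerS mulrACA IH exprSr invfM -natr1 natrD.
by field; rewrite expf_neq0.
Qed.

(** Pascal's rule as summation by parts: one more row of binomial coefficients
    replaces f by its differences. *)
Lemma alternating_binomialS N f :
  \sum_(j < N.+2) (-1) ^+ j * 'C(N.+1, j)%:R * f j
  = \sum_(j < N.+1) (-1) ^+ j * 'C(N, j)%:R * (f j - f j.+1).
Proof.
rewrite big_ord_recl bin0.
under eq_bigr => i _ do
  rewrite lift0 binS natrD (mulrDr ((-1) ^+ _)) mulrDl.
rewrite big_split/= big_ord_recr/= bin_small// mulr0 mul0r addr0.
under [in RHS]eq_bigr => i _ do rewrite mulrBr.
rewrite sumrB [in RHS]big_ord_recl bin0 /= -!addrA; congr (_ + (_ + _)).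
by rewrite -sumrN; apply: eq_bigr => i _; rewrite exprS; ring.
Qed.

(** Chu-Vandermonde, cleared of denominators so that it holds for all a and
    b; Pascal's rule turns one step into the factor b - a. *)
Lemma chu_vandermonde N a b :
  \sum_(s < N.+1) (-1) ^+ s * 'C(N, s)%:R
     * (pochhammer a s * pochhammer (b + s%:R) (N - s))
  = pochhammer (b - a) N.
Proof.
elim: N b => [|N IH] b.
  by rewrite big_ord1 bin0 !pochhammer0 !mulr1.
rewrite (alternating_binomialS N
  (fun i : nat => pochhammer a i * pochhammer (b + i%:R) (N.+1 - i))).
rewrite pochhammerSl (_ : b - a + 1 = b + 1 - a); last by ring.
rewrite -IH mulr_sumr; apply: eq_bigr => i _.
have iN : (i <= N)%N by rewrite -ltnS.
rewrite subSS subSn// pochhammerSl pochhammerS -natr1.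
rewrite (_ : b + i%:R + 1 = b + 1 + i%:R); last by ring.
by rewrite (_ : b + (i%:R + 1) = b + 1 + i%:R); ring.
Qed.

(** A terminating balanced 3F2 at 1, multiplied by the Pochhammer symbols of
    its denominators so that no parameter is excluded. *)
Definition saalschutz_sum k N s d :=
  \sum_(j < k.+1) (-1) ^+ j * 'C(k, j)%:R
     * (pochhammer (k%:R + s) j * pochhammer (d - j%:R) N
        * pochhammer (s + N%:R + 1 + j%:R) (k - j)).

(** (k - j) 'C(k, j) = (j + 1) 'C(k, j + 1), so consecutive terms cancel. *)
Lemma binomial_telescope k f :
  \sum_(j < k.+1) (-1) ^+ j * 'C(k, j)%:R
     * (j%:R * f j + (k - j)%:R * f j.+1) = 0.
Proof.
under eq_bigr => i _ do rewrite mulrDr.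
rewrite big_split/= big_ord_recl/= mul0r mulr0 add0r.
rewrite [X in _ + X]big_ord_recr/= subnn mul0r mulr0 addr0.
rewrite -big_split/= big1// => i _.
rewrite /bump add1n exprS.
have e : (k - i)%:R * 'C(k, i)%:R = i.+1%:R * 'C(k, i.+1)%:R :> C.
  by rewrite -!natrM mul_bin_left.
transitivity ((-1) ^+ i * f i.+1
  * ((k - i)%:R * 'C(k, i)%:R - i.+1%:R * 'C(k, i.+1)%:R) : C); first by ring.
by rewrite e subrr mulr0.
Qed.

(** The relation is not termwise: after Pascal's rule and multiplication by
    k + 1 + s, the two sides differ by a sum that binomial_telescope kills. *)
Lemma saalschutz_sumS k N s d : k.+1%:R + s != 0 ->
  saalschutz_sum k.+1 N.+1 s d
  = N.+1%:R * (d + s + N.+1%:R) * saalschutz_sum k N (s + 2%:R) d.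
Proof.
move=> ks; apply: (mulfI ks); rewrite /saalschutz_sum.
set f := fun j : nat => pochhammer (k.+1%:R + s) j * pochhammer (d - j%:R) N.+1
        * pochhammer (s + N.+1%:R + 1 + j%:R) (k.+1 - j).
rewrite (alternating_binomialS k f).
apply/esym/eqP; rewrite -subr_eq0; apply/eqP.
rewrite -[RHS](binomial_telescope k f) [X in X - _]mulrA !mulr_sumr -sumrB.
apply: eq_bigr => i _.
have ik : (i <= k)%N by rewrite -ltnS.
rewrite /f subSS subSn// natrB//.
rewrite [pochhammer (s + N.+1%:R + 1 + i%:R) _]pochhammerSl.
rewrite [pochhammer (k.+1%:R + s) i.+1]pochhammerS.
rewrite [pochhammer (d - i%:R) N.+1]pochhammerS.
rewrite [pochhammer (d - i.+1%:R) N.+1]pochhammerSl.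
have -> : d - i.+1%:R + 1 = d - i%:R by rewrite -natr1; ring.
have -> : s + N.+1%:R + 1 + i.+1%:R = s + N.+1%:R + 1 + i%:R + 1.
  by rewrite -!natr1; ring.
have -> : s + 2%:R + N%:R + 1 + i%:R = s + N.+1%:R + 1 + i%:R + 1.
  by rewrite -!natr1; ring.
have e : (k.+1%:R + s) * pochhammer (k%:R + (s + 2%:R)) i
    = pochhammer (k.+1%:R + s) i * (k.+1%:R + s + i%:R).
  rewrite -pochhammerS pochhammerSl -natr1; congr (_ * pochhammer _ _); ring.
set P := pochhammer (k%:R + (s + 2%:R)) i in e *.
rewrite -!natr1 in e *.
set Q := pochhammer (k%:R + 1 + s) i in e *.
transitivity ((-1) ^+ i * 'C(k, i)%:R * pochhammer (d - i%:R) N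
   * pochhammer (s + (N%:R + 1) + 1 + i%:R + 1) (k - i)
   * ((N%:R + 1) * (d + s + (N%:R + 1)) * ((k%:R + 1 + s) * P)
      - (k%:R + 1 + s) * (Q * (d - i%:R + N%:R) * (s + (N%:R + 1) + 1 + i%:R)
        - Q * (k%:R + 1 + s + i%:R) * (d - (i%:R + 1))))).
  by ring.
by rewrite e; ring.
Qed.

(** The case that the previous recurrence leaves out, by the same telescoping. *)
Lemma saalschutz_sumS0 k s d : k.+1%:R + s != 0 -> saalschutz_sum k.+1 0 s d = 0.
Proof.
move=> ks; apply: (mulfI ks); rewrite /saalschutz_sum mulr0.
under eq_bigr => i _ do rewrite [pochhammer (d - _) 0]pochhammer0 mulr1.
set f := fun j : nat => pochhammer (k.+1%:R + s) j
        * pochhammer (s + 0%:R + 1 + j%:R) (k.+1 - j).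
rewrite (alternating_binomialS k f).
apply: oppr_inj; rewrite oppr0 -[RHS](binomial_telescope k f).
rewrite mulr_sumr -sumrN; apply: eq_bigr => i _.
have ik : (i <= k)%N by rewrite -ltnS.
rewrite /f subSS subSn// natrB//.
rewrite [pochhammer (s + 0%:R + 1 + i%:R) _]pochhammerSl.
rewrite [pochhammer (k.+1%:R + s) i.+1]pochhammerS.
have -> : s + 0%:R + 1 + i.+1%:R = s + 0%:R + 1 + i%:R + 1.
  by rewrite -!natr1; ring.
by rewrite -!natr1; ring.
Qed.

(** Pfaff-Saalschutz, by induction on k.  The recurrence raises s by 2 and
    lowers N by 1, as one integration by parts against a Jacobi weight does.
    For N < k the falling factorial vanishes: this is orthogonality. *)
Lemma pfaff_saalschutz k N s d : (forall i, s + i.+1%:R != 0) ->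
  saalschutz_sum k N s d
  = (N ^_ k)%:R * pochhammer d (N - k) * pochhammer (d + s + N%:R) k.
Proof.
elim: k N s => [|k IH] N s hs.
  rewrite /saalschutz_sum big_ord1 bin0 !pochhammer0 subr0 subn0 ffactn0.
  by ring.
have ks : k.+1%:R + s != 0 by rewrite addrC hs.
case: N => [|N]; first by rewrite saalschutz_sumS0// ffact0n !mul0r.
rewrite saalschutz_sumS// IH => [|i]; last first.
  by rewrite -addrA -natrD add2n hs.
rewrite ffactSS subSS natrM pochhammerSl.
rewrite (_ : d + (s + 2%:R) + N%:R = d + s + N.+1%:R + 1); first by ring.
by rewrite -natr1; ring.
Qed.

End Hypergeometric.

(** * Complex exponential, logarithm and principal powers *)
Section ComplexPower.
Context {R : realType}.
Local Notation C := R[i].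
Local Notation normc := ComplexField.Normc.normc.
Implicit Types (z w nu : C) (r x y : R).

Lemma norm_normc z : `|z| = (normc z)%:C.
Proof. by case: z. Qed.

Lemma normc_ge0 z : 0 <= normc z.
Proof. by case: z => a b; exact: sqrtr_ge0. Qed.

Lemma normc_gt0 z : (0 < normc z) = (z != 0).
Proof.
rewrite lt_neqAle normc_ge0 andbT eq_sym; apply/idP/idP; apply: contraNN.
  by move=> /eqP ->; rewrite ComplexField.Normc.normc0.
by move=> /eqP /ComplexField.Normc.eq0_normc ->.
Qed.

Lemma normc_real r : normc r%:C = `|r|.
Proof. by rewrite /= expr0n /= addr0 sqrtr_sqr. Qed.

Lemma normc_nat n : normc (n%:R : C) = n%:R.
Proof. by rewrite -(rmorph_nat (real_complex R)) normc_real ger0_norm. Qed.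

Lemma normcX z n : normc (z ^+ n) = normc z ^+ n.
Proof.
elim: n => [|n IH]; first by rewrite !expr0 ComplexField.Normc.normc1.
by rewrite !exprS ComplexField.Normc.normcM IH.
Qed.

Lemma normcD z w : normc (z + w) <= normc z + normc w.
Proof. by rewrite -lecR rmorphD/= -!norm_normc ler_normD. Qed.

Lemma normcN z : normc (- z) = normc z.
Proof. by apply: complexI; rewrite -!norm_normc normrN. Qed.

Lemma normc_sum n (f : nat -> C) :
  normc (\sum_(0 <= i < n) f i) <= \sum_(0 <= i < n) normc (f i).
Proof.
elim: n => [|n IH]; first by rewrite !big_nil ComplexField.Normc.normc0.
by rewrite !big_nat_recr//= (le_trans (normcD _ _))// lerD2r.
Qed.

Lemma normRe_le_normc z : `|complex.Re z| <= normc z.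
Proof. by rewrite -lecR -norm_normc normc_ge_Re. Qed.

Lemma normIm_le_normc z : `|complex.Im z| <= normc z.
Proof.
case: z => a b /=; rewrite -sqrtr_sqr ler_wsqrtr//.
by rewrite lerDr sqr_ge0.
Qed.

Lemma CexpD z w : Cexp (z + w) = Cexp z * Cexp w.
Proof.
case: z w => a b [c d]; rewrite /Cexp /= expRD cosD sinD.
by simpc; congr (_ +i* _); ring.
Qed.

Lemma Cexp0 : Cexp 0 = 1 :> C.
Proof. by rewrite /Cexp /= expR0 cos0 sin0 mulr0 mulr1. Qed.

Lemma Cexp_real r : Cexp r%:C = (expR r)%:C.
Proof. by rewrite /Cexp /= cos0 sin0 mulr0 mulr1. Qed.

Lemma normc_Cexp z : normc (Cexp z) = expR (complex.Re z).
Proof.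
rewrite /= !exprMn -mulrDr cos2Dsin2 mulr1 sqrtr_sqr ger0_norm ?expR_ge0//.

Qed.

Lemma Cexp_neq0 z : Cexp z != 0.
Proof. by rewrite -normc_gt0 normc_Cexp expR_gt0. Qed.

(** The principal logarithm inverts Cexp on the strip of its values; most facts
    on principal powers below follow from this uniqueness. *)
Lemma CexpK z : - pi < complex.Im z <= pi -> Clog (Cexp z) = z.
Proof.
move=> /andP[z1 z2]; rewrite /Clog normc_Cexp expRK /Carg normc_Cexp /=.
have e0 := expR_gt0 (complex.Re z).
rewrite [expR _ * cos _]mulrC mulfK ?gt_eqF// pmulr_rge0//.
case: z z1 z2 e0 => a b /= b1 b2 _; congr (_ +i* _).
have [b0|b0] := leP 0 b.
  by rewrite sin_ge0_pi ?b0// cosK// in_itv/= b0.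
rewrite leNgt -oppr_gt0 -sinN sin_gt0_pi/=; last by lra.
by rewrite -cosN cosK ?opprK// in_itv/=; lra.
Qed.

Lemma Re_div_normc_itv w : w != 0 ->
  -1 <= complex.Re w / normc w <= 1.
Proof.
rewrite -normc_gt0 => w0; rewrite -ler_norml normrM normfV.
by rewrite (ger0_norm (normc_ge0 _)) ler_pdivrMr// mul1r normRe_le_normc.
Qed.

Lemma sin_Carg w : w != 0 -> normc w * sin (Carg w) = complex.Im w.
Proof.
move=> w0; have nw : 0 < normc w by rewrite normc_gt0.
have rw := Re_div_normc_itv w0; rewrite /Carg.
set c := _ / _ in rw *.
have s : normc w * sin (acos c) = `|complex.Im w|.
  rewrite sin_acos// -{1}(ger0_norm (ltW nw)) -!sqrtr_sqr -sqrtrM ?sqr_ge0//.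
  congr (Num.sqrt _); rewrite mulrBr mulr1 /c exprMn exprVn mulrCA.
  rewrite divff ?gt_eqF ?exprn_gt0// mulr1.
  case: w {w0 nw rw c} => a b /=.
  by rewrite sqr_sqrtr ?addr_ge0 ?sqr_ge0// addrC addKr.
case: leP => h; first by rewrite s ger0_norm.
by rewrite sinN mulrN s ltr0_norm ?opprK.
Qed.

Lemma Carg_itv w : w != 0 -> - pi < Carg w <= pi.
Proof.
move=> w0; have rw := Re_div_normc_itv w0.
have a0 := acos_ge0 rw; have api := acos_lepi rw; have p0 := @pi_gt0 R.
have := sin_Carg w0; rewrite /Carg /=; case: (leP 0 (complex.Im w)) => h s.
  by rewrite api andbT; lra.
apply/andP; split; last by lra.
rewrite ltrN2 lt_neqAle api andbT; apply/eqP => ap.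
by move: h; rewrite -s ap sinN sinpi oppr0 mulr0 ltxx.
Qed.

Lemma ClogK w : w != 0 -> Cexp (Clog w) = w.
Proof.
move=> w0; have nw : 0 < normc w by rewrite normc_gt0.
rewrite /Cexp /= lnK// (sin_Carg w0) /Carg.
have -> : forall t : R, cos (if 0 <= complex.Im w then t else - t) = cos t.
  by move=> t; case: ifP; rewrite ?cosN.
rewrite acosK; last by rewrite in_itv/= Re_div_normc_itv.
by rewrite mulrC divfK ?gt_eqF//; case: w {w0 nw}.
Qed.

Lemma Cpow_neq0 w z : w != 0 -> Cpow w z != 0.
Proof. by rewrite /Cpow => /negPf ->; exact: Cexp_neq0. Qed.

Lemma CpowD w z1 z2 : w != 0 -> Cpow w (z1 + z2) = Cpow w z1 * Cpow w z2.
Proof. by rewrite /Cpow => /negPf ->; rewrite mulrDl CexpD. Qed.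

Lemma Cpow0 w : Cpow w 0 = 1.
Proof. by rewrite /Cpow eqxx; case: eqP; rewrite ?mul0r ?Cexp0. Qed.

Lemma Cpow1 w : w != 0 -> Cpow w 1 = w.
Proof. by move=> w0; rewrite /Cpow (negPf w0) mul1r ClogK. Qed.

Lemma Cpow_nat w n : w != 0 -> Cpow w n%:R = w ^+ n.
Proof.
move=> w0; elim: n => [|n IH]; first by rewrite Cpow0.
by rewrite -natr1 CpowD// IH Cpow1// exprSr.
Qed.

Lemma real_complex_eq0 r : (r%:C == 0) = (r == 0).
Proof. by apply/eqP/eqP => [[]|->]. Qed.

Lemma Clog_real r : 0 < r -> Clog r%:C = (ln r)%:C.
Proof.
move=> r0; rewrite -{1}(lnK (r0 : r \in Num.pos)) -Cexp_real CexpK//=.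
by rewrite oppr_lt0 pi_gt0 pi_ge0.
Qed.

Lemma Cpow_real r a : 0 < r -> Cpow r%:C a%:C = (r `^ a)%:C.
Proof.
move=> r0; rewrite /Cpow /powR real_complex_eq0 (gt_eqF r0) Clog_real//.
by rewrite -rmorphM/= Cexp_real.
Qed.

Lemma ClogMr r w : 0 < r -> w != 0 -> Clog (r%:C * w) = (ln r)%:C + Clog w.
Proof.
move=> r0 w0; rewrite -{1}(lnK (r0 : r \in Num.pos)) -Cexp_real -{1}(ClogK w0).
rewrite -CexpD CexpK//=.
by rewrite add0r Carg_itv.
Qed.

(** A positive factor leaves the principal argument unchanged, so it splits
    off from a principal power. *)
Lemma CpowMr r w z : 0 < r -> w != 0 ->
  Cpow (r%:C * w) z = Cpow r%:C z * Cpow w z.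
Proof.
move=> r0 w0; rewrite /Cpow mulf_eq0 real_complex_eq0 (gt_eqF r0) (negPf w0)/=.
by rewrite ClogMr// Clog_real// mulrDr CexpD.
Qed.

Lemma Re_sqrtc_ge0 w : 0 <= complex.Re (sqrtc w).
Proof. by case: w => a b; exact: sqrtr_ge0. Qed.

Lemma Im_sqrtc_ge0 r : 0 <= complex.Im (sqrtc r%:C).
Proof. by rewrite /= eqxx mul1r sqrtr_ge0. Qed.

(** Halving the principal logarithm brings its imaginary part into
    ]-pi/2, pi/2], which singles out the principal square root. *)
Lemma Clog_sqrtc w : w != 0 -> Clog (sqrtc w) = Clog w / 2%:R.
Proof.
move=> w0; have p0 := @pi_gt0 R.
have /andP[a1 a2] := Carg_itv w0.
have : Clog w / 2%:R + Clog w / 2%:R = Clog w by rewrite -splitr.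
move: (Clog w / 2%:R) => l l2.
have eIm : complex.Im l = Carg w / 2%:R.
  have : complex.Im (l + l) = Carg w by rewrite l2.
  by case: (l) => x y /=; lra.
have itl : - (pi / 2) < complex.Im l <= pi / 2 by rewrite eIm; lra.
suff -> : sqrtc w = Cexp l by rewrite CexpK//; lra.
have /eqP : sqrtc w ^+ 2 = Cexp l ^+ 2.
  by rewrite sqr_sqrtc expr2 -CexpD l2 ClogK.
rewrite eqf_sqr => /orP[/eqP//|/eqP sN].
have := Re_sqrtc_ge0 w; rewrite sN /= oppr_ge0 pmulr_rle0 ?expR_gt0// => c0.
have lpi : complex.Im l = pi / 2.
  apply/eqP; case/andP: itl => i1; rewrite le_eqVlt => /orP[//|i2].
  by move: c0; rewrite leNgt cos_gt0_pihalf// i1.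
have wr : w = (complex.Re w)%:C.
  rewrite -[w in LHS]sqr_sqrtc sN sqrrN /Cexp lpi cos_pihalf sin_pihalf.
  have -> : complex.Re w = complex.Re ((sqrtc w) ^+ 2) by rewrite sqr_sqrtc.
  rewrite sN sqrrN /Cexp lpi cos_pihalf sin_pihalf mulr0 mulr1 expr2.
  by simpc.
have := Im_sqrtc_ge0 (complex.Re w); rewrite -wr sN /= lpi sin_pihalf mulr1.
by rewrite oppr_ge0 leNgt expR_gt0.
Qed.

Lemma Cpow_sqrtc w z : w != 0 -> Cpow (sqrtc w) z = Cpow w (z / 2%:R).
Proof.
move=> w0; rewrite /Cpow sqrtc_eq0 (negPf w0) Clog_sqrtc//.
by congr Cexp; ring.
Qed.

End ComplexPower.

(** * Limits and series of complex numbers *)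
Section ComplexLimits.
Context {R : realType}.
Local Notation C := R[i].
Local Notation normc := ComplexField.Normc.normc.
Implicit Types (u a b : nat -> C) (l s : C).

Lemma ReD (z w : C) : complex.Re (z + w) = complex.Re z + complex.Re w.
Proof. by case: z w => ? ? []. Qed.

Lemma ImD (z w : C) : complex.Im (z + w) = complex.Im z + complex.Im w.
Proof. by case: z w => ? ? []. Qed.

Lemma ReB (z w : C) : complex.Re (z - w) = complex.Re z - complex.Re w.
Proof. by case: z w => ? ? []. Qed.

Lemma ImB (z w : C) : complex.Im (z - w) = complex.Im z - complex.Im w.
Proof. by case: z w => ? ? []. Qed.

Lemma normc_le_ReIm (z : C) :
  normc z <= `|complex.Re z| + `|complex.Im z|.
Proof.
rewrite [X in normc X]complexE (le_trans (normcD _ _))// normc_real lerD2l.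
by rewrite ComplexField.Normc.normcM normc_real /= expr0n expr1n add0r sqrtr1 mul1r.
Qed.

Lemma cvgC_normcP (T : Type) (F : set_system T) {FF : Filter F} (f : T -> C) l :
  (f : T -> C^o) @ F --> (l : C^o) <->
  (forall e : R, 0 < e -> \forall x \near F, normc (l - f x) < e).
Proof.
rewrite (@cvgrPdist_lt C C^o); split => [h e e0|h e e0].
  have := h e%:C; rewrite ltcR => /(_ e0).
  by apply: filterS => x; rewrite (norm_normc (l - f x)) ltcR.
have /complex_realP [r er] : e \is Num.real by exact: gtr0_real.
move: e0; rewrite er ltcR => r0.
by apply: filterS (h r r0) => x; rewrite (norm_normc (l - f x)) ltcR.
Qed.

Lemma cvg_Re (T : Type) (F : set_system T) {FF : Filter F} (f : T -> C) l :
  (f : T -> C^o) @ F --> (l : C^o) -> complex.Re (f x) @[x --> F] --> complex.Re l.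
Proof.
move=> /cvgC_normcP h; apply/cvgrPdist_lt => e e0.
apply: filterS (h e e0) => x; apply: le_lt_trans.
by rewrite -ReB normRe_le_normc.
Qed.

Lemma cvg_Im (T : Type) (F : set_system T) {FF : Filter F} (f : T -> C) l :
  (f : T -> C^o) @ F --> (l : C^o) -> complex.Im (f x) @[x --> F] --> complex.Im l.
Proof.
move=> /cvgC_normcP h; apply/cvgrPdist_lt => e e0.
apply: filterS (h e e0) => x; apply: le_lt_trans.
by rewrite -ImB normIm_le_normc.
Qed.

Lemma cvg_ReIm (T : Type) (F : set_system T) {FF : Filter F} (f : T -> C) l :
  complex.Re (f x) @[x --> F] --> complex.Re l ->
  complex.Im (f x) @[x --> F] --> complex.Im l ->
  (f : T -> C^o) @ F --> (l : C^o).
Proof.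
move=> /cvgrPdist_lt h1 /cvgrPdist_lt h2; apply/cvgC_normcP => e e0.
have e2 : 0 < e / 2 by rewrite divr_gt0.
apply: filterS2 (h1 _ e2) (h2 _ e2) => x d1 d2.
rewrite (le_lt_trans (normc_le_ReIm _))// ReB ImB [e]splitr.
exact: ltrD.
Qed.

Lemma cvg_real_complex (T : Type) (F : set_system T) {FF : Filter F}
    (f : T -> R) (r : R) :
  f x @[x --> F] --> r -> ((f x)%:C : C^o) @[x --> F] --> (r%:C : C^o).
Proof. by move=> h; apply: cvg_ReIm => //; exact: cvg_cst. Qed.

Lemma cvgC_M (T : Type) (F : set_system T) {FF : Filter F} (f g : T -> C) l s :
  (f : T -> C^o) @ F --> (l : C^o) -> (g : T -> C^o) @ F --> (s : C^o) ->
  (fun x => f x * g x : C^o) @ F --> (l * s : C^o).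
Proof. by move=> hf hg; exact: (cvgM hf hg). Qed.

Lemma cvgC_D (T : Type) (F : set_system T) {FF : Filter F} (f g : T -> C) l s :
  (f : T -> C^o) @ F --> (l : C^o) -> (g : T -> C^o) @ F --> (s : C^o) ->
  (fun x => f x + g x : C^o) @ F --> (l + s : C^o).
Proof. by move=> hf hg; exact: (cvgD hf hg). Qed.

Lemma cvgC_cst (T : Type) (F : set_system T) {FF : Filter F} l :
  (fun _ : T => l : C^o) @ F --> (l : C^o).
Proof. exact: (@cvg_cst C^o). Qed.

Lemma cvgC_Ml (T : Type) (F : set_system T) {FF : Filter F} (f : T -> C) l s :
  (f : T -> C^o) @ F --> (l : C^o) -> (fun x => s * f x : C^o) @ F --> (s * l : C^o).
Proof.
by move=> hf; have hs := @cvgC_cst T F FF s; refine (cvgC_M hs hf).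
Qed.

Lemma cvgC_near (T : Type) (F : set_system T) {FF : Filter F} (f g : T -> C) l :
  (\forall x \near F, f x = g x) ->
  (f : T -> C^o) @ F --> (l : C^o) -> (g : T -> C^o) @ F --> (l : C^o).
Proof.
by move=> fg hf; apply: cvg_trans hf; apply: near_eq_cvg; apply: filterS fg => x ->.
Qed.

Lemma Clim_cvg u l : (u : nat -> C^o) @ \oo --> (l : C^o) -> Clim u = l.
Proof. by move=> h; rewrite /Clim; apply: (@cvg_lim C^o) h. Qed.

Lemma Cseries_cvg u s :
  (series u : nat -> C^o) @ \oo --> (s : C^o) -> Cseries u = s.
Proof. exact: Clim_cvg. Qed.

Lemma Re_series u n : complex.Re (series u n) = series (fun k => complex.Re (u k)) n.
Proof.
by elim: n => [|n IH]; rewrite /series /= ?big_nil// !big_nat_recr//= ReD; congr (_ + _).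
Qed.

Lemma Im_series u n : complex.Im (series u n) = series (fun k => complex.Im (u k)) n.
Proof.
by elim: n => [|n IH]; rewrite /series /= ?big_nil// !big_nat_recr//= ImD; congr (_ + _).
Qed.

Lemma normc_cvg_series u :
  cvgn (series (fun n => normc (u n))) ->
  exists s, (series u : nat -> C^o) @ \oo --> (s : C^o).
Proof.
move=> h.
have hre : cvgn (series (fun n => complex.Re (u n))).
  apply: normed_cvg; apply: series_le_cvg h => n //=; rewrite ?normr_ge0 ?normc_ge0//.
  exact: normRe_le_normc.
have him : cvgn (series (fun n => complex.Im (u n))).
  apply: normed_cvg; apply: series_le_cvg h => n //=; rewrite ?normr_ge0 ?normc_ge0//.
  exact: normIm_le_normc.
exists (limn (series (fun n => complex.Re (u n)))
        +i* limn (series (fun n => complex.Im (u n)))).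
by apply: cvg_ReIm => /=;
  [under eq_fun do rewrite Re_series|under eq_fun do rewrite Im_series].
Qed.

Lemma Cseries_finite u n : (forall k, (n <= k)%N -> u k = 0) ->
  Cseries u = \sum_(k < n) u k.
Proof.
move=> h; apply: Cseries_cvg; apply: cvg_near_cst.
exists n => //= m nm; rewrite /series /= (big_cat_nat _ nm)//=.
have -> : \sum_(n <= i < m) u i = 0.
  by rewrite big_nat_cond big1// => k /andP[/andP[/h]].
by rewrite addr0 big_mkord.
Qed.

Lemma sum_antidiagonal (V : zmodType) (f : nat -> nat -> V) n :
  \sum_(0 <= m < n) \sum_(i < m.+1) f i (m - i)%N
  = \sum_(0 <= i < n) \sum_(0 <= j < n - i) f i j.
Proof.
elim: n => [|n IH]; first by rewrite !big_nil.
rewrite big_nat_recr//= IH [RHS]big_nat_recr//= subSnn big_nat1.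
rewrite big_ord_recr/= subnn addrA; congr (_ + _).
rewrite -(big_mkord xpredT (fun i => f i (n - i)%N)) -big_split/=.
rewrite !big_nat; apply: eq_bigr => i /andP[_ ni].
by rewrite subSn ?(ltnW ni)// big_nat_recr.
Qed.

(** Cauchy product.  The square and triangular partial sums of the norms
    interleave, so they have the same limit; their difference dominates the
    difference of the square and triangular partial sums of the products. *)
Lemma cauchy_product a b (A B : C) :
  cvgn (series (fun n => normc (a n))) -> cvgn (series (fun n => normc (b n))) ->
  (series a : nat -> C^o) @ \oo --> (A : C^o) ->
  (series b : nat -> C^o) @ \oo --> (B : C^o) ->
  (series (fun n => \sum_(i < n.+1) a i * b (n - i)%N) : nat -> C^o) @ \oo
    --> (A * B : C^o).
Proof.
move=> na nb cA cB.
set tri := fun n => \sum_(0 <= i < n) \sum_(0 <= j < n - i) normc (a i) * normc (b j).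
set sq := fun n => series (fun n => normc (a n)) n * series (fun n => normc (b n)) n.
have t_ge0 i j : 0 <= normc (a i) * normc (b j) by rewrite mulr_ge0 ?normc_ge0.
have sqE n : sq n = \sum_(0 <= i < n) \sum_(0 <= j < n) normc (a i) * normc (b j).
  by rewrite /sq /series /= mulr_suml; apply: eq_bigr => i _; rewrite mulr_sumr.
have subE n : sq n - tri n = \sum_(0 <= i < n) \sum_(n - i <= j < n) normc (a i) * normc (b j).
  rewrite sqE /tri -sumrB; apply: eq_bigr => i _.
  by rewrite (big_cat_nat (leq0n (n - i)) (leq_subr i n))/= [X in X - _]addrC addrK.
have tri_sq n : tri n <= sq n.
  rewrite -subr_ge0 subE; apply: sumr_ge0 => i _; exact: sumr_ge0.
have sq_tri n : sq n <= tri n.*2.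
  rewrite sqE /tri -addnn (big_cat_nat (leq0n _) (leq_addr n n))/=.
  rewrite -[leLHS]addr0 lerD//; last by apply: sumr_ge0 => i _; exact: sumr_ge0.
  rewrite !big_nat; apply: ler_sum => i /andP[_ ni].
  have nn : (n <= n + n - i)%N by rewrite -addnBA ?(ltnW ni)// leq_addr.
  by rewrite (big_cat_nat (leq0n _) nn)/= lerDl sumr_ge0.
have tri_nd : nondecreasing_seq tri.
  apply/nondecreasing_seqP => n; rewrite /tri big_nat_recr//= subSnn.
  rewrite -[leLHS]addr0 lerD ?sumr_ge0//.
  rewrite !big_nat; apply: ler_sum => i /andP[_ ni].
  by rewrite subSn ?(ltnW ni)// big_nat_recr//= lerDl.
have csq : cvgn sq by apply: is_cvgM.
have sq_nd : nondecreasing_seq sq.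
  apply/nondecreasing_seqP => n; rewrite /sq.
  rewrite ler_pM// /series /= ?sumr_ge0// => [i _|i _||]; rewrite ?normc_ge0//.
    by rewrite big_nat_recr//= lerDl normc_ge0.
  by rewrite big_nat_recr//= lerDl normc_ge0.
have ctri : cvgn tri.
  apply: nondecreasing_is_cvgn => //; exists (limn sq) => _ [n _ <-].
  by rewrite (le_trans (tri_sq n))// nondecreasing_cvgn_le.
have c0 : sq n - tri n @[n --> \oo] --> 0.
  rewrite (_ : 0 = limn sq - limn tri); last first.
    apply/eqP; rewrite eq_sym subr_eq0 eq_le; apply/andP; split.
      apply: limr_le => //; near=> n.
      by rewrite (le_trans (sq_tri n))// nondecreasing_cvgn_le.
    by apply: ler_lim => //; near=> n; exact: tri_sq.
  exact: cvgB.
have cP : (fun n => series a n * series b n : C^o) @ \oo --> (A * B : C^o).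
  exact: cvgM cA cB.
apply/cvgC_normcP => e e0; have e2 : 0 < e / 2 by rewrite divr_gt0.
move/cvgC_normcP/(_ _ e2) : cP => h1.
move/cvgrPdist_lt/(_ _ e2) : c0 => h2.
apply: filterS2 h1 h2 => n h1 h2.
rewrite [e]splitr -(subrK (series a n * series b n) (A * B)) -addrA.
rewrite (le_lt_trans (normcD _ _))// ltrD//.
apply: le_lt_trans h2; rewrite sub0r normrN ger0_norm ?subr_ge0//.
rewrite subE.
have -> := sum_antidiagonal (fun i j => a i * b j) n : series _ n = _.
have -> : series a n * series b n = \sum_(0 <= i < n) \sum_(0 <= j < n) a i * b j.
  by rewrite /series /= mulr_suml; apply: eq_bigr => i _; rewrite mulr_sumr.
rewrite -sumrB (le_trans (normc_sum _ _))//; apply: ler_sum => i _.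
rewrite (big_cat_nat (leq0n (n - i)) (leq_subr i n))/= [X in X - _]addrC addrK.
have -> : \sum_(n - i <= j < n) a i * b j = \sum_(0 <= j < n - (n - i)) a i * b (j + (n - i))%N.
  by rewrite -{1}[(n - i)%N]add0n big_addn.
have -> : \sum_(n - i <= j < n) normc (a i) * normc (b j)
   = \sum_(0 <= j < n - (n - i)) normc (a i * b (j + (n - i))%N).
  rewrite -{1}[(n - i)%N]add0n big_addn; apply: eq_bigr => j _.
  by rewrite ComplexField.Normc.normcM.
exact: normc_sum.
Unshelve. all: by end_near.
Qed.

End ComplexLimits.

(** * The Gauss product for the reciprocal Gamma function *)
Section GaussProduct.
Context {R : realType}.
Local Notation C := R[i].
Implicit Types (z : C) (a x : R).

Lemma rGammaE z :
  rGamma z = Clim (fun n => pochhammer z n.+1 / (n`!%:R * Cpow n%:R z)).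
Proof. by []. Qed.

Lemma Cnat_neq0 n : (n.+1%:R : C) != 0.
Proof. by rewrite pnatr_eq0. Qed.

Lemma gauss_shift z n : (0 < n)%N ->
  z * (pochhammer (z + 1) n.+1 / (n`!%:R * Cpow n%:R (z + 1)))
  = pochhammer z n.+1 / (n`!%:R * Cpow n%:R z) * ((z + 1 + n%:R) / n%:R).
Proof.
move=> n0; have n0' : (n%:R : C) != 0 by rewrite pnatr_eq0 -lt0n.
rewrite CpowD// Cpow1// mulrA -pochhammerSl pochhammerS -natr1.
have f0 : (n`!%:R : C) != 0 by rewrite pnatr_eq0 -lt0n fact_gt0.
have p0 := Cpow_neq0 z n0'.
by field; rewrite ?f0 ?p0 ?n0'.
Qed.

Lemma cvg_nat_ratio z : ((z + n%:R) / n%:R : C^o) @[n --> \oo] --> (1 : C^o).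
Proof.
rewrite -cvg_shiftS /=.
have -> : (fun n => (z + n.+1%:R) / n.+1%:R : C^o)
    = (fun n => z * (harmonic n)%:C + 1 : C^o).
  apply/funext => n; rewrite mulrDl divff ?Cnat_neq0//=.
  by rewrite fmorphV /= rmorph_nat.
suff h : (z * (harmonic n)%:C + 1 : C^o) @[n --> \oo] --> (z * 0 + 1 : C^o).
  by rewrite mulr0 add0r in h.
refine (cvgC_D _ (@cvgC_cst R nat \oo _ 1)).
refine (@cvgC_Ml R nat \oo _ (fun n => (harmonic n)%:C) 0 z _).
refine (@cvg_real_complex R nat \oo _ harmonic 0 _).
exact: cvg_harmonic.
Qed.

(** The functional equation needs no convergence: up to the factor z, the ratio
    of corresponding terms of the two Gauss sequences tends to 1, so for z <> 0
    either both limits exist or both are the default value 0. *)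
Lemma rGammaS z : z * rGamma (z + 1) = rGamma z.
Proof.
have [->|z0] := eqVneq z 0.
  rewrite mul0r rGammaE; apply/esym/Clim_cvg.
  under eq_fun do rewrite pochhammerSl mul0r mul0r.
  exact: cvg_cst.
rewrite 2!rGammaE; set v := (X in z * Clim X); set u := (X in _ = Clim X).
have vu : \forall n \near \oo, u n * ((z + 1 + n%:R) / n%:R) / z = v n.
  by exists 1%N => // n n0; rewrite -gauss_shift//= mulrC mulKf.
have ratio := cvg_nat_ratio (z + 1).
have uv : \forall n \near \oo, v n * z / ((z + 1 + n%:R) / n%:R) = u n.
  have /cvgC_normcP/(_ 1 ltr01) h := ratio.
  apply: filterS2 h vu => n h <-.
  rewrite divfK// mulfK//; apply/eqP => e.
  by move: h; rewrite e subr0 ComplexField.Normc.normc1 ltxx.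
have uvP (l : C) : (u : nat -> C^o) @ \oo --> (l : C^o) ->
    (v : nat -> C^o) @ \oo --> (l * 1 / z : C^o).
  move=> ul; refine (cvgC_near vu _).
  refine (cvgC_M (cvgC_M ul ratio) (@cvgC_cst R nat \oo _ z^-1)).
have vuP (l : C) : (v : nat -> C^o) @ \oo --> (l : C^o) ->
    (u : nat -> C^o) @ \oo --> (l * z / 1 : C^o).
  move=> vl; refine (cvgC_near uv _).
  refine (cvgC_M (cvgC_M vl (@cvgC_cst R nat \oo _ z)) _).
  refine (cvgV (oner_neq0 C) ratio).
have [/cvg_ex [l ul]|ncu] := pselect (cvg ((u : nat -> C^o) @ \oo)).
  by rewrite (Clim_cvg ul) (Clim_cvg (uvP _ ul)) mulr1 mulrC divfK.
have ncv : ~ cvg ((v : nat -> C^o) @ \oo).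
  by move=> /cvg_ex [l vl]; apply: ncu; apply/cvg_ex; exists (l * z / 1); exact: vuP.
by rewrite /Clim (dvgP ncu) (dvgP ncv) mulr0.
Qed.

Lemma rGamma_pochhammer z n : pochhammer z n * rGamma (z + n%:R) = rGamma z.
Proof.
elim: n => [|n IH]; first by rewrite pochhammer0 mul1r addr0.
by rewrite pochhammerS -mulrA -natr1 addrA rGammaS.
Qed.

Definition gauss_prod a n : R :=
  \prod_(i < n.+1) (a + i%:R) / (n`!%:R * n%:R `^ a).

Lemma gauss_prod_complex a n : (0 < n)%N ->
  pochhammer a%:C n.+1 / (n`!%:R * Cpow n%:R a%:C) = (gauss_prod a n)%:C.
Proof.
move=> n0; rewrite /gauss_prod rmorphM fmorphV rmorphM /= rmorph_nat.
rewrite -Cpow_real ?ltr0n// rmorph_nat; congr (_ / _).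
by rewrite /pochhammer rmorph_prod; apply: eq_bigr => i _; rewrite rmorphD rmorph_nat.
Qed.

Lemma bernoulli_powR x a : 0 < x -> 0 < a <= 1 -> x `^ a <= a * x + (1 - a).
Proof.
move=> x0 /andP[a0]; rewrite le_eqVlt => /orP[/eqP->|a1].
  by rewrite powRr1 ?(ltW x0)// subrr addr0 mul1r.
have a1' : 0 < 1 - a by rewrite subr_gt0.
have := @conjugate_powR R (x `^ a) 1 a^-1 (1 - a)^-1 (powR_ge0 _ _) ler01.
rewrite !invr_gt0 !invrK => /(_ a0 a1' (subrKC _ _)).
by rewrite mulr1 powR1 mul1r -powRrM divff ?gt_eqF// powRr1 ?(ltW x0)// [x * a]mulrC.
Qed.

Lemma gauss_prod_gt0 a n : 0 < a -> (0 < n)%N -> 0 < gauss_prod a n.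
Proof.
move=> a0 n0; rewrite divr_gt0 ?mulr_gt0 ?powR_gt0 ?ltr0n ?fact_gt0//.
by apply: prodr_gt0 => i _; rewrite ltr_wpDr ?ler0n.
Qed.

Lemma gauss_prodS a n : (0 < n)%N ->
  gauss_prod a n.+1
  = gauss_prod a n * ((a + n.+1%:R) / n.+1%:R * (n%:R / n.+1%:R) `^ a).
Proof.
move=> n0; rewrite /gauss_prod big_ord_recr/= factS natrM.
have n0' : 0 < n%:R :> R by rewrite ltr0n.
have n1 : 0 < n.+1%:R :> R by rewrite ltr0n.
have f0 : 0 < n`!%:R :> R by rewrite ltr0n fact_gt0.
have e : n%:R `^ a = (n%:R / n.+1%:R) `^ a * n.+1%:R `^ a :> R.
  by rewrite -powRM ?divr_ge0// divfK// gt_eqF.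
have p0 : 0 < (n%:R / n.+1%:R : R) `^ a by rewrite powR_gt0 ?divr_gt0.
have p1 := powR_gt0 a n1.
rewrite e; move: n1 p0 p1; rewrite -natr1 => n1 p0 p1.
by field; rewrite ?gt_eqF.
Qed.

Lemma gauss_prod_shift a n : 0 < a -> (0 < n)%N ->
  gauss_prod (a + 1) n = gauss_prod a n * ((a + 1 + n%:R) / n%:R) / a.
Proof.
move=> a0 n0; apply: complexI; rewrite -gauss_prod_complex// rmorphM rmorphM/=.
rewrite -gauss_prod_complex//= fmorphV/= fmorph_div/= !rmorphD/= rmorph_nat.
rewrite (_ : 1%:C = 1)//.
rewrite -gauss_shift//.
by rewrite [a%:C * _]mulrC mulfK// real_complex_eq0 gt_eqF.
Qed.

Lemma cvg_nat_ratioR a : (a + n%:R) / n%:R @[n --> \oo] --> (1 : R).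
Proof.
have /cvg_Re := cvg_nat_ratio a%:C.
by under eq_fun do rewrite -(rmorph_nat (real_complex R)) -rmorphD -fmorph_div/=.
Qed.

(** On ]0, 1] Bernoulli's inequality makes the Gauss sequence decrease and,
    with a telescoping factor, keeps it above a positive constant; the
    functional equation does the rest. *)
Lemma gauss_prod_cvg a : 0 < a ->
  exists2 l : R, 0 < l & gauss_prod a @ \oo --> l.
Proof.
have small x : 0 < x <= 1 -> exists2 l : R, 0 < l & gauss_prod x @ \oo --> l.
  move=> x01; have /andP[x0 x1] := x01.
  pose v n := gauss_prod x n.+1.
  have v0 n : 0 < v n by rewrite gauss_prod_gt0.
  have n2 n : 0 < n.+2%:R :> R by rewrite ltr0n.
  have n1 n : 0 < n.+1%:R :> R by rewrite ltr0n.
  have vS n : v n.+1 = v n * ((x + n.+2%:R) / n.+2%:R * (n.+1%:R / n.+2%:R) `^ x).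
    by rewrite /v gauss_prodS.
  have vdec : nonincreasing_seq v.
    apply/nonincreasing_seqP => n; rewrite vS -[leRHS]mulr1 ler_pM2l//.
    have h : (n.+1%:R / n.+2%:R) `^ x <= 1 - x / n.+2%:R.
      rewrite (le_trans (bernoulli_powR _ x01)) ?divr_gt0//.
      by rewrite -(natr1 n.+1) le_eqVlt; apply/orP; left; apply/eqP; field; rewrite gt_eqF.
    have k0 : 0 <= (x + n.+2%:R) / n.+2%:R by rewrite divr_ge0 ?addr_ge0 ?ltW.
    rewrite (le_trans (ler_wpM2l k0 h))// mulrDl divff ?gt_eqF//.
    by set t := x / _; have := sqr_ge0 t; nra.
  (* v is compared with a constant multiple of 1 + x / n.+1, the product of
     Bernoulli's lower bounds, which telescopes. *)
  have vlow n : v 0%N / (1 + x) <= v n * (n.+1%:R / (n.+1%:R + x)).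
    elim: n => [|n IH]; first by rewrite mul1r.
    rewrite (le_trans IH)// vS -[leRHS]mulrA ler_pM2l//.
    have e y p : 0 < y -> (x + y) / y * p * (y / (y + x)) = p :> R.
      by move=> y0; rewrite (addrC y); field; rewrite !gt_eqF ?addr_gt0.
    rewrite e// -[leLHS]invrK -[leRHS]invrK lef_pV2; last 2 first.
    - by rewrite posrE invr_gt0 divr_gt0 ?addr_gt0.
    - by rewrite posrE invr_gt0 powR_gt0 ?divr_gt0.
    rewrite -powRN -mulN1r powRrM powR_inv1 ?divr_ge0 ?ler0n// !invf_div.
    rewrite (le_trans (bernoulli_powR _ x01)) ?divr_gt0//.
    by rewrite -(natr1 n.+1) le_eqVlt; apply/orP; left; apply/eqP; field; rewrite gt_eqF.
  pose c := v 0%N / (1 + x).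
  have c0 : 0 < c by rewrite divr_gt0// addr_gt0.
  have vc n : c <= v n.
    rewrite (le_trans (vlow n))// -[leRHS]mulr1 ler_pM2l//.
    by rewrite ler_pdivrMr ?addr_gt0// mul1r lerDl ltW.
  have cv : cvgn v.
    by apply: nonincreasing_is_cvgn => //; exists c => _ [n _ <-].
  exists (limn v); last by rewrite -cvg_shiftS.
  by rewrite (lt_le_trans c0)//; apply: limr_ge => //; near=> n; exact: vc.
suff H m x : 0 < x <= m.+1%:R -> exists2 l : R, 0 < l & gauss_prod x @ \oo --> l.
  move=> a0; apply: (H (Num.bound a)); rewrite a0/=.
  rewrite (le_trans (ltW (archi_boundP (ltW a0))))// ler_nat; exact: leqnSn.
elim: m x => [|m IH] x /andP[x0 xm]; first by apply: small; rewrite x0.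
have [x1|x1] := leP x 1; first by apply: small; rewrite x0.
have y0 : 0 < x - 1 by rewrite subr_gt0.
have [|l l0 hl] := IH (x - 1).
  by rewrite y0/= lerBlDr natr1.
exists (l / (x - 1)); first by rewrite divr_gt0.
have e : \forall n \near \oo,
    gauss_prod (x - 1) n * ((x - 1 + 1 + n%:R) / n%:R) / (x - 1) = gauss_prod x n.
  by exists 1%N => // n n1; rewrite -gauss_prod_shift ?subrK.
apply: cvg_trans; first by apply: near_eq_cvg; exact: e.
rewrite -[l]mulr1.
by apply: cvgM; [apply: cvgM => //; exact: cvg_nat_ratioR|exact: cvg_cst].
Unshelve. all: by end_near.
Qed.

Definition rGammaR a : R := limn (gauss_prod a).

Lemma cvg_gauss_prod a : 0 < a -> gauss_prod a @ \oo --> rGammaR a.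
Proof. by move=> /gauss_prod_cvg[l _ h]; apply/cvg_ex; exists l. Qed.

Lemma rGammaR_gt0 a : 0 < a -> 0 < rGammaR a.
Proof. by move=> /gauss_prod_cvg[l l0 h]; rewrite /rGammaR (cvg_lim _ h). Qed.

Lemma rGamma_real a : 0 < a -> rGamma a%:C = (rGammaR a)%:C.
Proof.
move=> a0; rewrite rGammaE; apply: Clim_cvg.
have /cvg_real_complex h := cvg_gauss_prod a0.
apply: cvg_trans h; apply: near_eq_cvg; exists 1%N => // n n1.
by rewrite gauss_prod_complex.
Qed.

Lemma rGammaRS a : 0 < a -> a * rGammaR (a + 1) = rGammaR a.
Proof.
move=> a0; apply: complexI; rewrite rmorphM /= -!rGamma_real ?addr_gt0//.
by rewrite rmorphD rmorph1 rGammaS.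
Qed.

End GaussProduct.

(** * Euler's beta integral on ]-1, 1[ *)
Section BetaIntegral.
Context {R : realType}.
Local Notation mu := (@lebesgue_measure R).
Local Notation D := (`]-1, 1[%classic : set R).
Implicit Types (a b x : R) (f F : R -> R).

(** Distance from the endpoints of an inner interval; n.+3 keeps it below 1, so
    that every inner interval is nondegenerate. *)
Definition inset n : R := 2%:R / n.+3%:R.

Lemma inset_gt0 n : 0 < inset n.
Proof. by rewrite divr_gt0// ltr0n. Qed.

Lemma inset_lt1 n : inset n < 1.
Proof. by rewrite ltr_pdivrMr ?ltr0n// mul1r ltr_nat. Qed.

Lemma inset_decr n m : (n <= m)%N -> inset m <= inset n.
Proof.
by move=> nm; rewrite ler_pM2l// lef_pV2 ?posrE ?ltr0n// ler_nat !ltnS.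
Qed.

Lemma inset_half n : inset n / 2%:R = n.+3%:R^-1.
Proof. by rewrite /inset mulrC mulKf ?pnatr_eq0. Qed.

Lemma cvg_inv_nat3 : (n.+3%:R^-1 : R) @[n --> \oo] --> 0.
Proof.
have := @cvg_harmonic R; rewrite -(cvg_shiftn 2) /=.
by under eq_fun do rewrite addn2.
Qed.

Definition inner n := `[-1 + inset n, 1 - inset n]%classic.

Lemma inner_sub n : inner n `<=` D.
Proof.
move=> x; rewrite /inner /= !in_itv/= => /andP[h1 h2].
by have := inset_gt0 n; lra.
Qed.

Lemma bigcup_inner : \bigcup_n inner n = D.
Proof.
apply/seteqP; split => [x [n _]|x]; first exact: inner_sub.
rewrite /= in_itv/= => /andP[h1 h2].
have [n hn] : exists n, inset n < Num.min (1 + x) (1 - x).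
  have m0 : 0 < Num.min (1 + x) (1 - x) / 2%:R by rewrite divr_gt0// lt_min; lra.
  have /cvgrPdist_lt/(_ _ m0) [n _ /(_ n (leqnn n))] := cvg_inv_nat3.
  rewrite sub0r normrN ger0_norm ?invr_ge0// ltr_pdivlMr// mulrC => h.
  by exists n.
exists n => //; rewrite /inner /= in_itv/=.
by move: hn; rewrite lt_min => /andP[? ?]; lra.
Qed.

Lemma continuous_measurable_on f :
  (forall x, D x -> {for x, continuous f}) -> measurable_fun D f.
Proof.
by move=> cf; apply: open_continuous_measurable_fun => // x /set_mem; exact: cf.
Qed.

Lemma cvg_integral_inner f :
  (forall x, D x -> {for x, continuous f}) -> (forall x, D x -> 0 <= f x) ->
  (\int[mu]_(x in inner n) (f x)%:E)%E @[n --> \oo]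
    --> (\int[mu]_(x in D) (f x)%:E)%E.
Proof.
move=> cf f0; rewrite -bigcup_inner.
apply: ge0_nondecreasing_set_cvg_integral.
- move=> n m nm; apply/subsetPset => x; rewrite /inner /= !in_itv/=.
  by have := inset_decr nm; lra.
- by move=> n; exact: measurable_itv.
- move=> n; apply/measurable_EFinP.
  by apply: measurable_funS (continuous_measurable_on cf) => //; exact: inner_sub.
- by move=> n x /inner_sub/f0; rewrite lee_fin.
Qed.

Lemma FTC_inner f F n :
  (forall x, D x -> {for x, continuous f}) ->
  (forall x, D x -> is_derive x 1 F (f x)) ->
  (\int[mu]_(x in inner n) (f x)%:E)%E
  = (F (1 - inset n) - F (-1 + inset n))%:E.
Proof.
move=> cf dF; rewrite EFinB; have n0 := inset_gt0 n; have n1 := inset_lt1 n.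
have cF x : D x -> {for x, continuous F}.
  by move=> /dF [dx _]; apply: differentiable_continuous; exact/derivable1_diffP.
have inD x : x \in `](-1 + inset n), (1 - inset n)[ -> D x.
  by rewrite /= !in_itv/= => /andP[? ?]; lra.
apply: continuous_FTC2; first by lra.
- apply: continuous_in_subspaceT => x /set_mem /inner_sub; exact: cf.
- split.
  + by move=> x /inD/dF[].
  + by apply: cvg_at_right_filter; apply: cF; rewrite /= in_itv/=; lra.
  + by apply: cvg_at_left_filter; apply: cF; rewrite /= in_itv/=; lra.
- by move=> x /inD/dF h; rewrite derive1E derive_val.
Qed.

(** Improper fundamental theorem for a difference of two nonnegative
    integrands: signs are separated so that each half is exhausted
    monotonically. *)
Lemma FTC_open_interval (f g F : R -> R) (A B : R) :
  (forall x, D x -> {for x, continuous f}) ->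
  (forall x, D x -> {for x, continuous g}) ->
  (forall x, D x -> 0 <= f x) -> (forall x, D x -> 0 <= g x) ->
  mu.-integrable D (EFin \o g) ->
  (forall x, D x -> is_derive x 1 F (f x - g x)) ->
  F (1 - inset n) @[n --> \oo] --> B ->
  F (-1 + inset n) @[n --> \oo] --> A ->
  (\int[mu]_(x in D) (f x)%:E = (B - A)%:E + \int[mu]_(x in D) (g x)%:E)%E.
Proof.
move=> cf cg f0 g0 ig dF cB cA.
have cfg x : D x -> {for x, continuous (fun x => f x - g x)}.
  by move=> Dx; apply: (@cvgB _ R^o); [exact: cf|exact: cg].
have mE n : measurable (inner n) by exact: measurable_itv.
have cint h n : (forall x, D x -> {for x, continuous h}) ->
    mu.-integrable (inner n) (EFin \o h).
  move=> ch; apply: continuous_compact_integrable; first exact: segment_compact.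
  by apply: continuous_in_subspaceT => x /set_mem /inner_sub; exact: ch.
have key n : (\int[mu]_(x in inner n) (f x)%:E
    = (F (1 - inset n) - F (-1 + inset n))%:E + \int[mu]_(x in inner n) (g x)%:E)%E.
  rewrite -(FTC_inner n cfg dF) -integralD//.
  - by apply: eq_integral => x _; rewrite -EFinD subrK.
  - exact: mE.
  - exact: (cint (fun x => f x - g x)).
  - exact: cint.
have := cvg_integral_inner cf f0.
under eq_fun do rewrite key.
move=> hf; apply: (cvg_unique _ hf) => //.
apply: cvgeD => //.
- by apply: cvg_EFin; [exact: nearW|exact: cvgB].
- exact: cvg_integral_inner.
Qed.

Lemma half_itv x : D x -> 0 < (1 - x) / 2%:R < 1 /\ 0 < (1 + x) / 2%:R < 1.
Proof. by rewrite /= in_itv/= => /andP[? ?]; split; lra. Qed.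

Lemma is_derive_half_powR (s p x : R) : 0 < (1 + s * x) / 2%:R ->
  is_derive x 1 (fun x => ((1 + s * x) / 2%:R) `^ p)
    (s / 2%:R * p * ((1 + s * x) / 2%:R) `^ (p - 1)).
Proof.
move=> x0.
have dg : is_derive x 1 (fun x => (1 + s * x) / 2%:R) (s / 2%:R).
  have -> : (fun x => (1 + s * x) / 2%:R) = 2%:R^-1 \*: (cst 1 + s \*: id) :> (R -> R).
    by apply/funext => y /=; rewrite mulrC.
  by apply: is_derive_eq; rewrite add0r /GRing.scale /= mulr1 mulrC.
have dp := is_derive1_powR p x0.
have dc : is_derive x 1 (fun x => ((1 + s * x) / 2%:R) `^ p)
    (p * ((1 + s * x) / 2%:R) `^ (p - 1) * (s / 2%:R)) :=
    @is_derive1_comp R (fun y => y `^ p) (fun x => (1 + s * x) / 2%:R) x _ _ dp dg.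
by apply: (is_derive_eq dc); ring.
Qed.

Definition beta_weight a b x :=
  ((1 - x) / 2%:R) `^ (a - 1) * ((1 + x) / 2%:R) `^ (b - 1).

Lemma beta_weight_ge0 a b x : 0 <= beta_weight a b x.
Proof. by rewrite mulr_ge0 ?powR_ge0. Qed.

Lemma is_derive_left p x : D x ->
  is_derive x 1 (fun x => ((1 - x) / 2%:R) `^ p)
    (- (p / 2%:R) * ((1 - x) / 2%:R) `^ (p - 1)).
Proof.
move=> Dx; have [/andP[x0 _] _] := half_itv Dx.
have := @is_derive_half_powR (-1) p x.
rewrite (_ : (fun y => _) = (fun x => ((1 - x) / 2%:R) `^ p)); last first.
  by apply/funext => y; rewrite mulN1r.
by rewrite mulN1r => /(_ x0) h; apply: (is_derive_eq h); ring.
Qed.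

Lemma is_derive_right p x : D x ->
  is_derive x 1 (fun x => ((1 + x) / 2%:R) `^ p)
    (p / 2%:R * ((1 + x) / 2%:R) `^ (p - 1)).
Proof.
move=> Dx; have [_ /andP[x0 _]] := half_itv Dx.
have := @is_derive_half_powR 1 p x.
rewrite (_ : (fun y => _) = (fun x => ((1 + x) / 2%:R) `^ p)); last first.
  by apply/funext => y; rewrite mul1r.
by rewrite mul1r => /(_ x0) h; apply: (is_derive_eq h); ring.
Qed.

Lemma is_derive_beta_primitive a b x : D x ->
  is_derive x 1 (fun x => ((1 - x) / 2%:R) `^ a * ((1 + x) / 2%:R) `^ b)
    (b / 2%:R * beta_weight (a + 1) b x - a / 2%:R * beta_weight a (b + 1) x).
Proof.
move=> Dx; have d := is_deriveM (is_derive_left a Dx) (is_derive_right b Dx).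
apply: (is_derive_eq d); rewrite /beta_weight !addrK /GRing.scale /=; ring.
Qed.

Lemma is_derive_continuous f x (l : R) : is_derive x 1 f l -> {for x, continuous f}.
Proof.
by move=> [dx _]; apply: differentiable_continuous; exact/derivable1_diffP.
Qed.

Lemma continuous_beta_weight a b x : D x -> {for x, continuous (beta_weight a b)}.
Proof.
move=> Dx; have := @is_derive_beta_primitive (a - 1) (b - 1) x Dx.
exact: is_derive_continuous.
Qed.

Lemma powR_half_cvg0 p : 0 < p -> (inset n / 2%:R) `^ p @[n --> \oo] --> 0.
Proof.
move=> p0; have /cvg_at_rightP h := powR_cvg0 p0.
apply: (h (fun n => inset n / 2%:R)); split.
  by move=> n; rewrite divr_gt0// inset_gt0.
by under eq_fun do rewrite inset_half; exact: cvg_inv_nat3.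
Qed.

Lemma powR_half_cvg1 p : ((2%:R - inset n) / 2%:R) `^ p @[n --> \oo] --> (1 : R).
Proof.
have c1 : {for (1 : R), continuous (fun y : R => y `^ p)}.
  exact: is_derive_continuous (is_derive1_powR p ltr01).
suff : ((2%:R - inset n) / 2%:R) @[n --> \oo] --> (1 : R).
  move=> h; have := continuous_cvg _ c1 h; rewrite powR1; exact.
have h : (1 - n.+3%:R^-1) @[n --> \oo] --> (1 - 0 : R).
  by apply: cvgB; [exact: cvg_cst|exact: cvg_inv_nat3].
rewrite subr0 in h.
by under eq_fun do rewrite mulrBl inset_half divff//.
Qed.

Lemma beta_weight_left a x : beta_weight a 1 x = ((1 - x) / 2%:R) `^ (a - 1).
Proof. by rewrite /beta_weight subrr powRr0 mulr1. Qed.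

Lemma beta_weight_right b x : beta_weight 1 b x = ((1 + x) / 2%:R) `^ (b - 1).
Proof. by rewrite /beta_weight subrr powRr0 mul1r. Qed.

Lemma measurable_beta_weight a b : measurable_fun D (beta_weight a b).
Proof. by apply: continuous_measurable_on => x; exact: continuous_beta_weight. Qed.

Lemma integrable_fin_ge0 f (l : R) : measurable_fun D f ->
  (forall x, D x -> 0 <= f x) -> (\int[mu]_(x in D) (f x)%:E = l%:E)%E ->
  mu.-integrable D (EFin \o f).
Proof.
move=> mf f0 fl; apply/integrableP; split; first exact/measurable_EFinP.
under eq_integral => x /set_mem Dx do rewrite /= ger0_norm ?f0//.
by rewrite fl ltry.
Qed.

Lemma integral_beta_left a : 0 < a ->
  (\int[mu]_(x in D) (a / 2%:R * beta_weight a 1 x)%:E = 1%:E)%E.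
Proof.
move=> a0.
have h := @FTC_open_interval (fun x => a / 2%:R * beta_weight a 1 x) (cst 0)
  (fun x => - ((1 - x) / 2%:R) `^ a) (-1) 0.
transitivity ((0 - -1)%:E + \int[mu]_(x in D) (cst (0 : R) x)%:E)%E; last first.
  by rewrite integral0 adde0 sub0r opprK.
apply: h => //.
- move=> x Dx; apply: (@cvgM _ R); first exact: cvg_cst.
  exact: continuous_beta_weight.
- by move=> x _; exact: cvg_cst.
- by move=> x _; rewrite mulr_ge0 ?beta_weight_ge0// divr_ge0// ltW.
- exact: integrable0.
- move=> x Dx; apply: (is_derive_eq (is_deriveN (is_derive_left a Dx))).
  by rewrite beta_weight_left /=; ring.
- rewrite -oppr0; apply: cvgN; under eq_fun do rewrite opprB addrC subrK.
  exact: powR_half_cvg0.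
- apply: cvgN; under eq_fun do rewrite opprD opprK addrA.
  exact: powR_half_cvg1.
Qed.

Lemma integral_beta_right b : 0 < b ->
  (\int[mu]_(x in D) (b / 2%:R * beta_weight 1 b x)%:E = 1%:E)%E.
Proof.
move=> b0.
have h := @FTC_open_interval (fun x => b / 2%:R * beta_weight 1 b x) (cst 0)
  (fun x => ((1 + x) / 2%:R) `^ b) 0 1.
transitivity ((1 - 0)%:E + \int[mu]_(x in D) (cst (0 : R) x)%:E)%E; last first.
  by rewrite integral0 adde0 subr0.
apply: h => //.
- move=> x Dx; apply: (@cvgM _ R); first exact: cvg_cst.
  exact: continuous_beta_weight.
- by move=> x _; exact: cvg_cst.
- by move=> x _; rewrite mulr_ge0 ?beta_weight_ge0// divr_ge0// ltW.
- exact: integrable0.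
- move=> x Dx; apply: (is_derive_eq (is_derive_right b Dx)).
  by rewrite beta_weight_right /=; ring.
- under eq_fun do rewrite addrA.
  exact: powR_half_cvg1.
- under eq_fun do rewrite addrA subrr add0r.
  exact: powR_half_cvg0.
Qed.

Lemma integrable_beta_left a : 0 < a -> mu.-integrable D (EFin \o beta_weight a 1).
Proof.
move=> a0; have -> : EFin \o beta_weight a 1
    = (fun x => (2%:R / a)%:E * (a / 2%:R * beta_weight a 1 x)%:E)%E.
  by apply/funext => x /=; rewrite -EFinM; congr _%:E; field; rewrite gt_eqF.
apply: integrableZl => //.
apply: (integrable_fin_ge0 _ _ (integral_beta_left a0)).
- by apply: measurable_funM => //; exact: measurable_beta_weight.
- by move=> x _; rewrite mulr_ge0 ?beta_weight_ge0// divr_ge0// ltW.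
Qed.

Lemma integrable_beta_right b : 0 < b -> mu.-integrable D (EFin \o beta_weight 1 b).
Proof.
move=> a0; have -> : EFin \o beta_weight 1 b
    = (fun x => (2%:R / b)%:E * (b / 2%:R * beta_weight 1 b x)%:E)%E.
  by apply/funext => x /=; rewrite -EFinM; congr _%:E; field; rewrite gt_eqF.
apply: integrableZl => //.
apply: (integrable_fin_ge0 _ _ (integral_beta_right a0)).
- by apply: measurable_funM => //; exact: measurable_beta_weight.
- by move=> x _; rewrite mulr_ge0 ?beta_weight_ge0// divr_ge0// ltW.
Qed.

Lemma powR_half_bound p (t : R) : 2%:R^-1 <= t <= 1 -> t `^ p <= 1 + 2%:R^-1 `^ p.
Proof.
move=> /andP[t1 t2]; have t0 : 0 < t by rewrite (lt_le_trans _ t1).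
have [p0|p0] := leP 0 p.
  rewrite ler_wpDr ?powR_ge0// -[leRHS](powRr0 t).
  by apply: ger_powR => //; rewrite t0.
rewrite ler_wpDl// -[p]opprK !(powRN _ (- p)).
rewrite lef_pV2 ?posrE ?powR_gt0//.
by apply: ge0_ler_powR; rewrite ?nnegrE ?oppr_ge0 ?invr_ge0 ?(ltW p0) ?(ltW t0).
Qed.

(** Each half of the interval sees only one endpoint singularity. *)
Lemma beta_weight_bound a b x : D x ->
  beta_weight a b x <= (1 + 2%:R^-1 `^ (b - 1)) * beta_weight a 1 x
                     + (1 + 2%:R^-1 `^ (a - 1)) * beta_weight 1 b x.
Proof.
move=> Dx; have [/andP[u0 u1] /andP[v0 v1]] := half_itv Dx.
have k0 p : 0 <= 1 + 2%:R^-1 `^ p :> R by rewrite addr_ge0 ?powR_ge0.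
have [x0|x0] := leP 0 x.
  apply: ler_wpDr; first by rewrite mulr_ge0 ?beta_weight_ge0 ?k0.
  rewrite beta_weight_left mulrC.
  by rewrite ler_wpM2l ?powR_ge0// powR_half_bound//; lra.
apply: ler_wpDl; first by rewrite mulr_ge0 ?beta_weight_ge0 ?k0.
rewrite beta_weight_right.
by rewrite ler_wpM2r ?powR_ge0// powR_half_bound//; lra.
Qed.

Lemma integrable_beta_weight a b : 0 < a -> 0 < b ->
  mu.-integrable D (EFin \o beta_weight a b).
Proof.
move=> a0 b0.
have i1 := integrableZl _ (1 + 2%:R^-1 `^ (b - 1)) (integrable_beta_left a0).
have i2 := integrableZl _ (1 + 2%:R^-1 `^ (a - 1)) (integrable_beta_right b0).
apply: (le_integrable _ _ _ (integrableD _ (i1 _) (i2 _))) => //.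
- by apply/measurable_EFinP; exact: measurable_beta_weight.
- move=> x Dx /=; rewrite lee_fin ger0_norm ?beta_weight_ge0//.
  by rewrite (le_trans (beta_weight_bound _ _ Dx))// ler_norm.
Qed.

Definition beta_int a b : R := \int[mu]_(x in D) beta_weight a b x.

Lemma beta_int_EFin a b : 0 < a -> 0 < b ->
  (\int[mu]_(x in D) (beta_weight a b x)%:E = (beta_int a b)%:E)%E.
Proof.
move=> a0 b0; rewrite /beta_int /Rintegral fineK//.
by apply: integrable_fin_num => //; exact: integrable_beta_weight.
Qed.

Lemma beta_int_split a b : 0 < a -> 0 < b ->
  beta_int a b = beta_int (a + 1) b + beta_int a (b + 1).
Proof.
move=> a0 b0; rewrite /beta_int -RintegralD//; last 2 first.
- by apply: integrable_beta_weight; rewrite ?addr_gt0.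
- by apply: integrable_beta_weight; rewrite ?addr_gt0.
apply: eq_Rintegral => x /set_mem Dx.
have [/andP[u0 _] /andP[v0 _]] := half_itv Dx.
have hD (t p : R) : 0 < t -> t `^ p = t `^ (p - 1) * t.
  move=> t0; rewrite -[X in _ * X](powRr1 (ltW t0)) -powRD ?subrK//.
  by rewrite (gt_eqF t0) implybT.
by rewrite /beta_weight !addrK (hD _ a u0) (hD _ b v0); field.
Qed.

(** Integration by parts: the boundary terms vanish because both exponents of
    the primitive are positive. *)
Lemma beta_int_parts a b : 0 < a -> 0 < b ->
  b * beta_int (a + 1) b = a * beta_int a (b + 1).
Proof.
move=> a0 b0.
have iw c d : 0 < c -> 0 < d -> mu.-integrable D (EFin \o beta_weight c d).
  exact: integrable_beta_weight.
have ig : mu.-integrable D (EFin \o (fun x => a / 2%:R * beta_weight a (b + 1) x)).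
  have -> : EFin \o (fun x => a / 2%:R * beta_weight a (b + 1) x)
      = (fun x => (a / 2%:R)%:E * (EFin \o beta_weight a (b + 1)) x)%E.
    by apply/funext => x /=; rewrite EFinM.
  by apply: integrableZl => //; apply: iw; rewrite ?addr_gt0.
have cw k c d x : D x -> {for x, continuous (fun x => k * beta_weight c d x)}.
  move=> Dx; apply: (@cvgM _ R); first exact: cvg_cst.
  exact: continuous_beta_weight.
have w0 k c d x : 0 < k -> 0 <= k / 2%:R * beta_weight c d x.
  by move=> k0; rewrite mulr_ge0 ?beta_weight_ge0// divr_ge0// ltW.
have h := @FTC_open_interval (fun x => b / 2%:R * beta_weight (a + 1) b x)
  (fun x => a / 2%:R * beta_weight a (b + 1) x)
  (fun x => ((1 - x) / 2%:R) `^ a * ((1 + x) / 2%:R) `^ b) 0 0.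
have {h} : (\int[mu]_(x in D) (b / 2%:R * beta_weight (a + 1) b x)%:E
   = (0 - 0)%:E + \int[mu]_(x in D) (a / 2%:R * beta_weight a (b + 1) x)%:E)%E.
  apply: h => //.
  - by move=> x; exact: cw.
  - by move=> x; exact: cw.
  - by move=> x _; exact: w0.
  - by move=> x _; exact: w0.
  - by move=> x; exact: is_derive_beta_primitive.
  - rewrite -[X in _ --> X](mul0r 1); apply: cvgM.
      under eq_fun do rewrite opprB addrC subrK; exact: powR_half_cvg0.
    under eq_fun do rewrite addrA; exact: powR_half_cvg1.
  - rewrite -[X in _ --> X](mulr0 1); apply: cvgM.
      under eq_fun do rewrite opprD opprK addrA; exact: powR_half_cvg1.
    under eq_fun do rewrite addrA subrr add0r; exact: powR_half_cvg0.
under eq_integral do rewrite EFinM.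
under [in X in _ = X -> _]eq_integral do rewrite EFinM.
rewrite !integralZl//; [|by apply: iw; rewrite ?addr_gt0..].
rewrite !beta_int_EFin ?addr_gt0// subrr add0e -!EFinM => -[].
by move=> h; lra.
Qed.

Lemma beta_intSr a b : 0 < a -> 0 < b ->
  (a + b) * beta_int a (b + 1) = b * beta_int a b.
Proof.
move=> a0 b0; rewrite (beta_int_split a0 b0) mulrDr beta_int_parts//.
by rewrite -mulrDl.
Qed.

Lemma beta_int1 a : 0 < a -> a * beta_int a 1 = 2%:R.
Proof.
move=> a0; have := integral_beta_left a0.
under eq_integral do rewrite EFinM.
rewrite integralZl//; last exact: integrable_beta_left.
rewrite beta_int_EFin// -EFinM => -[] h.
have : (a / 2%:R * beta_int a 1) * 2%:R = 2%:R by rewrite h mul1r.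
by rewrite mulrAC divfK.
Qed.

Lemma beta_int_antitone a b c : 0 < a -> 0 < b -> b <= c ->
  beta_int a c <= beta_int a b.
Proof.
move=> a0 b0 bc; apply: le_Rintegral => //.
- by apply: integrable_beta_weight => //; exact: lt_le_trans bc.
- exact: integrable_beta_weight.
- move=> x Dx; have [_ /andP[v0 v1]] := half_itv Dx.
  rewrite ler_wpM2l ?powR_ge0//; apply: ger_powR; first by rewrite v0 ltW.
  by rewrite lerD2r.
Qed.

Lemma beta_int_ratio a b n : 0 < a -> 0 < b ->
  \prod_(i < n) (a + b + i%:R) * beta_int a (b + n%:R)
  = \prod_(i < n) (b + i%:R) * beta_int a b.
Proof.
move=> a0 b0; elim: n => [|n IH]; first by rewrite !big_ord0 !mul1r addr0.
have bn0 : 0 < b + n%:R by rewrite ltr_wpDr ?ler0n.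
rewrite !big_ord_recr/= -natr1 addrA -[a + b + _]addrA -mulrA beta_intSr//.
by rewrite mulrCA IH; ring.
Qed.

Lemma beta_int_gauss a b n : 0 < a -> 0 < b -> (0 < n)%N ->
  beta_int a (b + n.+1%:R) * n%:R `^ a * gauss_prod (a + b) n
  = beta_int a b * gauss_prod b n.
Proof.
move=> a0 b0 n0; have n0' : 0 < n%:R :> R by rewrite ltr0n.
have f0 : 0 < n`!%:R :> R by rewrite ltr0n fact_gt0.
have := beta_int_ratio n.+1 a0 b0; rewrite /gauss_prod.
rewrite powRD; last by rewrite (gt_eqF n0') implybT.
set P := \prod_(i < n.+1) _; set Q := \prod_(i < n.+1) _ => e.
have pa := powR_gt0 a n0'; have pb := powR_gt0 b n0'.
transitivity (P * beta_int a (b + n.+1%:R) / (n`!%:R * n%:R `^ b)).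
  by field; rewrite !gt_eqF.
by rewrite e; field; rewrite !gt_eqF ?addr_gt0.
Qed.

Lemma beta_int_nat a n : 0 < a -> (0 < n)%N ->
  beta_int a n.+1%:R * n%:R `^ a * gauss_prod a n = 2%:R.
Proof.
move=> a0 n0; have n0' : 0 < n%:R :> R by rewrite ltr0n.
have f0 : 0 < n`!%:R :> R by rewrite ltr0n fact_gt0.
have pa := powR_gt0 a n0'.
have := beta_int_ratio n a0 ltr01; rewrite nat1r => e.
have fE : \prod_(i < n) (1 + i%:R) = n`!%:R :> R.
  rewrite fact_prod big_add1 big_mkord natr_prod; apply: eq_bigr => i _.
  by rewrite nat1r.
rewrite /gauss_prod big_ord_recl addr0.
have -> : \prod_(i < n) (a + (lift ord0 i)%:R) = \prod_(i < n) (a + 1 + i%:R).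
  by apply: eq_bigr => i _; rewrite lift0 -nat1r addrA.
transitivity (a * (\prod_(i < n) (a + 1 + i%:R) * beta_int a n.+1%:R) / n`!%:R).
  by field; rewrite !gt_eqF.
by rewrite e fE mulrCA beta_int1//; field; rewrite gt_eqF.
Qed.

(** Euler's beta integral.  For 0 < b <= 1 the integrals with second parameter
    b + n + 1 lie between those with integer parameters n + 2 and n + 1, which
    are explicit; Gauss products turn this into the identity in the limit. *)
Lemma beta_int_rGamma a b : 0 < a -> 0 < b ->
  beta_int a b * rGammaR a * rGammaR b = 2%:R * rGammaR (a + b).
Proof.
move=> a0.
have small c : 0 < c <= 1 ->
    beta_int a c * rGammaR a * rGammaR c = 2%:R * rGammaR (a + c).
  move=> /andP[c0 c1].
  pose s n := beta_int a (c + n.+1%:R) * n%:R `^ a * gauss_prod a n.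
  have lim1 : s n * gauss_prod (a + c) n @[n --> \oo]
      --> beta_int a c * rGammaR a * rGammaR c.
    have h : beta_int a c * gauss_prod a n * gauss_prod c n @[n --> \oo]
      --> beta_int a c * rGammaR a * rGammaR c.
      apply: cvgM; last exact: cvg_gauss_prod.
      by apply: cvgM; [exact: cvg_cst|exact: cvg_gauss_prod].
    apply: cvg_trans h; apply: near_eq_cvg; exists 1%N => // n n0.
    by rewrite mulrAC -beta_int_gauss// /s; ring.
  have s_le n : (0 < n)%N -> s n <= 2%:R.
    move=> n0; rewrite -(beta_int_nat a0 n0) /s.
    rewrite ler_wpM2r ?(ltW (gauss_prod_gt0 _ _))// ler_wpM2r ?powR_ge0//.
    by apply: beta_int_antitone; rewrite ?ltr0n// lerDr ltW.
  have s_ge n : (0 < n)%N -> 2%:R * (n.+1%:R / (a + n.+1%:R)) <= s n.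
    move=> n0; rewrite -(beta_int_nat a0 n0) /s.
    have n1 : 0 < n.+1%:R :> R by rewrite ltr0n.
    have <- : beta_int a (n.+1%:R + 1) * n%:R `^ a * gauss_prod a n
       = beta_int a n.+1%:R * n%:R `^ a * gauss_prod a n * (n.+1%:R / (a + n.+1%:R)).
      have e := beta_intSr a0 n1.
      have -> : beta_int a (n.+1%:R + 1) = n.+1%:R * beta_int a n.+1%:R / (a + n.+1%:R).
        by rewrite -e mulrAC mulfV ?mul1r// gt_eqF ?addr_gt0.
      by rewrite !mulrA; ring.
    rewrite ler_wpM2r ?(ltW (gauss_prod_gt0 _ _))// ler_wpM2r ?powR_ge0//.
    by apply: beta_int_antitone; rewrite ?addr_gt0// addrC lerD2l.
  have lim2 : s n @[n --> \oo] --> (2%:R : R).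
    have r : 2%:R * (n.+1%:R / (a + n.+1%:R)) @[n --> \oo] --> (2%:R : R).
      rewrite -[X in _ --> X]mulr1; apply: cvgM; first exact: cvg_cst.
      have h : ((a + n.+1%:R) / n.+1%:R)^-1 @[n --> \oo] --> (1^-1 : R).
        apply: cvgV; first exact: oner_neq0.
        by have := cvg_nat_ratioR a; rewrite -cvg_shiftS.
      by move: h; rewrite invr1; under eq_fun do rewrite invf_div.
    apply: (squeeze_cvgr _ r (@cvg_cst R 2%:R _ \oo _)).
    by exists 1%N => // n n0; rewrite s_ge// s_le.
  have lim3 : s n * gauss_prod (a + c) n @[n --> \oo] --> 2%:R * rGammaR (a + c).
    by apply: cvgM => //; apply: cvg_gauss_prod; exact: addr_gt0.
  exact: (cvg_unique (@Rhausdorff R) lim1 lim3).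
suff H m c : 0 < c <= m.+1%:R ->
    beta_int a c * rGammaR a * rGammaR c = 2%:R * rGammaR (a + c).
  move=> b0; apply: (H (Num.bound b)); rewrite b0/=.
  rewrite (le_trans (ltW (archi_boundP (ltW b0))))// ler_nat; exact: leqnSn.
elim: m c => [|m IH] c /andP[c0 cm]; first by apply: small; rewrite c0.
have [c1|c1] := leP c 1; first by apply: small; rewrite c0.
have d0 : 0 < c - 1 by rewrite subr_gt0.
have := IH (c - 1); rewrite d0/= lerBlDr natr1 => /(_ cm).
have := beta_intSr a0 d0; have := rGammaRS d0; have := rGammaRS (addr_gt0 a0 d0).
rewrite -[a + (c - 1) + 1]addrA !subrK => e1 e2 e3.
rewrite -e1 -e2 => h.
have ad0 : (c - 1) * (a + (c - 1)) != 0 by rewrite mulf_neq0// ?(gt_eqF d0) ?(gt_eqF (addr_gt0 a0 d0)).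
apply: (mulfI ad0).
transitivity (((a + (c - 1)) * beta_int a c) * rGammaR a * ((c - 1) * rGammaR c)).
  ring.
rewrite e3; transitivity ((c - 1) * (beta_int a (c - 1) * rGammaR a * ((c - 1) * rGammaR c))).
  ring.
by rewrite h; ring.
Qed.

End BetaIntegral.

(** * Integrals of complex-valued functions *)
Section ComplexIntegral.
Context {R : realType}.
Local Notation C := R[i].
Local Notation mu := (@lebesgue_measure R).
Local Notation normc := ComplexField.Normc.normc.
Variable D : set R.
Hypothesis mD : measurable D.
Implicit Types (f g : R -> C) (h : R -> R) (c : C).

Lemma eq_Cintegrable f g : (forall x, D x -> f x = g x) ->
  Cintegrable D g -> Cintegrable D f.
Proof.
move=> fg [g1 g2]; split.
- by apply: eq_integrable g1 => // x /set_mem Dx; rewrite fg.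
- by apply: eq_integrable g2 => // x /set_mem Dx; rewrite fg.
Qed.

Lemma eq_Cintegral f g : (forall x, D x -> f x = g x) ->
  Cintegral D f = Cintegral D g.
Proof.
move=> fg; rewrite /Cintegral.
by congr (_ +i* _); apply: eq_Rintegral => x /set_mem Dx; rewrite fg.
Qed.

Lemma Cintegrable_real h : mu.-integrable D (EFin \o h) ->
  Cintegrable D (fun x => (h x)%:C).
Proof. by move=> ih; split => //=; exact: integrable0. Qed.

Lemma Cintegral_real h : Cintegral D (fun x => (h x)%:C) = (\int[mu]_(x in D) h x)%:C.
Proof.
by rewrite /Cintegral; congr (_ +i* _); rewrite /Rintegral /= integral0.
Qed.

Lemma ReM c (z : C) : complex.Re (c * z)
  = complex.Re c * complex.Re z - complex.Im c * complex.Im z.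
Proof. by case: c z => ? ? []. Qed.

Lemma ImM c (z : C) : complex.Im (c * z)
  = complex.Re c * complex.Im z + complex.Im c * complex.Re z.
Proof. by case: c z => ? ? []. Qed.

Lemma integrable_RZl h (k : R) : mu.-integrable D (EFin \o h) ->
  mu.-integrable D (EFin \o (fun x => k * h x)).
Proof.
move=> ih; have -> : EFin \o (fun x => k * h x) = (fun x => k%:E * (EFin \o h) x)%E.
  by apply/funext => x /=; rewrite EFinM.
exact: integrableZl.
Qed.

Lemma CintegrableZl c f : Cintegrable D f -> Cintegrable D (fun x => c * f x).
Proof.
move=> [f1 f2]; split.
- under eq_fun do rewrite ReM EFinB.
  by apply: integrableB => //; exact: integrable_RZl.
- under eq_fun do rewrite ImM EFinD.
  by apply: integrableD => //; exact: integrable_RZl.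
Qed.

Lemma CintegralZl c f : Cintegrable D f ->
  Cintegral D (fun x => c * f x) = c * Cintegral D f.
Proof.
move=> [f1 f2]; rewrite /Cintegral.
under eq_Rintegral do rewrite ReM.
under [in X in _ +i* X]eq_Rintegral do rewrite ImM.
rewrite RintegralB ?RintegralD//; [|exact: integrable_RZl..].
by rewrite !RintegralZl//; case: c => c1 c2 /=; simpc.
Qed.

Lemma CintegrableD f g : Cintegrable D f -> Cintegrable D g ->
  Cintegrable D (fun x => f x + g x).
Proof.
move=> [f1 f2] [g1 g2]; split.
- by under eq_fun do rewrite ReD EFinD; exact: integrableD.
- by under eq_fun do rewrite ImD EFinD; exact: integrableD.
Qed.

Lemma CintegralD f g : Cintegrable D f -> Cintegrable D g ->
  Cintegral D (fun x => f x + g x) = Cintegral D f + Cintegral D g.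
Proof.
move=> [f1 f2] [g1 g2]; rewrite /Cintegral.
under eq_Rintegral do rewrite ReD.
under [in X in _ +i* X]eq_Rintegral do rewrite ImD.
by rewrite !RintegralD.
Qed.

Lemma Cintegrable_sum (F : nat -> R -> C) n :
  (forall i, Cintegrable D (F i)) -> Cintegrable D (fun x => \sum_(i < n) F i x).
Proof.
move=> iF; elim: n => [|n IH].
  by under eq_fun do rewrite big_ord0; exact: Cintegrable_real (integrable0 _ _).
under eq_fun do rewrite big_ord_recr/=.
exact: CintegrableD.
Qed.

Lemma Cintegral_sum (F : nat -> R -> C) n :
  (forall i, Cintegrable D (F i)) ->
  Cintegral D (fun x => \sum_(i < n) F i x) = \sum_(i < n) Cintegral D (F i).
Proof.
move=> iF; elim: n => [|n IH].
  rewrite big_ord0; under eq_fun do rewrite big_ord0.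
  by rewrite (Cintegral_real (cst 0)) /Rintegral /= integral0.
rewrite big_ord_recr/= -IH -CintegralD//; last exact: Cintegrable_sum.
by under eq_fun do rewrite big_ord_recr/=.
Qed.

Lemma dominated_Rintegral (h_ : nat -> R -> R) h (g : R -> R) :
  (forall n, mu.-integrable D (EFin \o h_ n)) ->
  (forall x, D x -> h_ n x @[n --> \oo] --> h x) ->
  mu.-integrable D (EFin \o g) ->
  (forall n x, D x -> `|h_ n x| <= g x) ->
  mu.-integrable D (EFin \o h) /\
  (\int[mu]_(x in D) h_ n x) @[n --> \oo] --> \int[mu]_(x in D) h x.
Proof.
move=> ih_ hh ig hg.
have mh_ n : measurable_fun D (h_ n).
  by apply/measurable_EFinP; exact: measurable_int (ih_ n).
have mh : measurable_fun D h by exact: (measurable_fun_cvg mh_).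
have [|||||ih _ cv] := @dominated_convergence _ _ R mu D mD
    (fun n => EFin \o h_ n) (EFin \o h) (EFin \o g).
- by move=> n; apply/measurable_EFinP; exact: mh_.
- by apply/measurable_EFinP; exact: mh.
- by apply: aeW => x Dx; apply: cvg_EFin; [exact: nearW|exact: hh].
- exact: ig.
- by apply: aeW => x n Dx /=; rewrite lee_fin hg.
split => //; apply: fine_cvg; rewrite fineK//.
exact: integrable_fin_num.
Qed.

Lemma dominated_Cintegral (f_ : nat -> R -> C) f (g : R -> R) :
  (forall n, Cintegrable D (f_ n)) ->
  (forall x, D x -> (f_ n x : C^o) @[n --> \oo] --> (f x : C^o)) ->
  mu.-integrable D (EFin \o g) ->
  (forall n x, D x -> normc (f_ n x) <= g x) ->
  Cintegrable D f /\
  (Cintegral D (f_ n) : C^o) @[n --> \oo] --> (Cintegral D f : C^o).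
Proof.
move=> if_ ff ig fg.
have [i1 c1] := @dominated_Rintegral (fun n x => complex.Re (f_ n x))
    (fun x => complex.Re (f x)) g (fun n => (if_ n).1) (fun x Dx => cvg_Re (ff x Dx)) ig
    (fun n x Dx => le_trans (normRe_le_normc _) (fg n x Dx)).
have [i2 c2] := @dominated_Rintegral (fun n x => complex.Im (f_ n x))
    (fun x => complex.Im (f x)) g (fun n => (if_ n).2) (fun x Dx => cvg_Im (ff x Dx)) ig
    (fun n x Dx => le_trans (normIm_le_normc _) (fg n x Dx)).
by split; [split|exact: cvg_ReIm].
Qed.

End ComplexIntegral.

(** * Bessel functions, Jacobi polynomials and the continued 2F3 *)
Section SpecialFunctions.
Context {R : realType}.
Local Notation C := R[i].
Local Notation normc := ComplexField.Normc.normc.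
Implicit Types (u : nat -> C) (z nu w c : C).

Lemma Cseries0 : Cseries (fun _ : nat => 0 : C) = 0.
Proof. by rewrite (@Cseries_finite R _ 0)// big_ord0. Qed.

(** Scalars leave a sum even without convergence, since a divergent series has
    sum 0. *)
Lemma CseriesZl c u : Cseries (fun n => c * u n) = c * Cseries u.
Proof.
have [->|c0] := eqVneq c 0.
  by rewrite mul0r; under eq_fun do rewrite mul0r; exact: Cseries0.
have sE a v : series (fun n => a * v n : C) = (fun n => a * series v n).
  by apply/funext => n; rewrite /series /= mulr_sumr.
have [/cvg_ex [l ul]|ncu] := pselect (cvg ((series u : nat -> C^o) @ \oo)).
  rewrite (Cseries_cvg ul); apply: Cseries_cvg; rewrite sE.
  exact: cvgC_Ml.
have ncv : ~ cvg ((series (fun n => c * u n) : nat -> C^o) @ \oo).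
  move=> /cvg_ex [l]; rewrite sE => vl; apply: ncu; apply/cvg_ex; exists (c^-1 * l).
  have h : (fun n => c^-1 * (c * series u n) : C^o) @ \oo --> (c^-1 * l : C^o).
    exact: cvgC_Ml.
  by rewrite (_ : (fun n => _) = series u) in h; [|apply/funext => n; rewrite mulKf].
by rewrite /Cseries /Clim (dvgP ncu) (dvgP ncv) mulr0.
Qed.

Definition bessel_coef nu n : C := rGamma (nu + n%:R + 1) / n`!%:R.

(** The functional equation has the factor nu + n + 1, of modulus at least 1 for
    large n, so these values of 1/Gamma eventually decrease in modulus. *)
Lemma rGamma_bounded nu :
  exists B : R, forall n, normc (rGamma (nu + n%:R + 1)) <= B.
Proof.
set c := fun n : nat => normc (rGamma (nu + n%:R + 1)).
have c0 n : 0 <= c n by exact: normc_ge0.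
have [N hN] : exists N : nat, 1 + normc (nu + 1) <= N%:R.
  exists (Num.bound (1 + normc (nu + 1))).
  by apply/ltW/archi_boundP; rewrite addr_ge0 ?normc_ge0.
have dec n : (N <= n)%N -> c n.+1 <= c n.
  move=> Nn; rewrite /c -(rGammaS (nu + n%:R + 1)).
  have -> : nu + n.+1%:R + 1 = nu + n%:R + 1 + 1 by rewrite -natr1; ring.
  rewrite ComplexField.Normc.normcM ler_peMl ?normc_ge0//.
  have h := normcD (nu + n%:R + 1) (- (nu + 1)).
  rewrite normcN (_ : _ - _ = n%:R) in h; last by ring.
  have Nn' : N%:R <= n%:R :> R by rewrite ler_nat.
  by rewrite normc_nat in h; lra.
exists (\sum_(i < N.+1) c i) => n.
have small m : (m <= N)%N -> c m <= \sum_(i < N.+1) c i.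
  rewrite -ltnS => mN; rewrite (bigD1 (Ordinal mN))//= lerDl.
  exact: sumr_ge0.
have [nN|Nn] := leqP n N; first exact: small.
rewrite (le_trans _ (small N (leqnn N)))//.
elim: n Nn => // n IH; rewrite ltnS leq_eqVlt => /orP[/eqP<-|Nn].
  exact: dec.
by rewrite (le_trans (dec _ (ltnW Nn)))// IH.
Qed.

Lemma bessel_coef_summable nu (r : R) : 0 <= r ->
  cvgn (series (fun n => normc (bessel_coef nu n) * r ^+ n)).
Proof.
move=> r0; have [B hB] := rGamma_bounded nu.
have cB : cvgn (series (fun n => B * exp_coeff r n)).
  exact: is_cvg_seriesZ (is_cvg_series_exp_coeff r).
apply: series_le_cvg cB => n.
- by rewrite mulr_ge0 ?normc_ge0 ?exprn_ge0.
- by rewrite mulr_ge0 ?(le_trans (normc_ge0 _) (hB 0%N))// exp_coeff_ge0.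
rewrite /bessel_coef ComplexField.Normc.normcM ComplexField.Normc.normcV normc_nat.
rewrite /exp_coeff /= mulrAC -mulrA.
by rewrite ler_wpM2r ?mulr_ge0 ?exprn_ge0 ?invr_ge0// hB.
Qed.

(** Both branches of the definition are the same series, since
    rGamma (nu + 1) / (nu + 1)_n = rGamma (nu + n + 1) when no factor of the
    Pochhammer symbol vanishes. *)
Lemma besselE sgn nu z : z != 0 ->
  bessel sgn nu z = Cpow (z / 2%:R) nu
    * Cseries (fun n => bessel_coef nu n * (sgn * (z ^+ 2 / 4%:R)) ^+ n).
Proof.
move=> z0; have z2 : z / 2%:R != 0 by rewrite mulf_neq0 ?invr_eq0 ?pnatr_eq0.
rewrite /bessel; case: asboolP => [_|nneg].
  rewrite -CseriesZl; congr Cseries; apply/funext => n.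
  have e : (z / 2%:R) ^+ 2 = z ^+ 2 / 4%:R by rewrite expr_div_n -natrX.
  rewrite CpowD// -natrM Cpow_nat// exprM e [(sgn * _) ^+ n]exprMn /bessel_coef.
  by ring.
rewrite /Gamma invrK -mulrA; congr (_ * _).
rewrite /pFq -CseriesZl; congr Cseries; apply/funext => n.
rewrite big_nil big_cons big_nil mulr1 /bessel_coef.
have -> : nu + n%:R + 1 = nu + 1 + n%:R by ring.
rewrite -(rGamma_pochhammer (nu + 1) n); field.
rewrite pnatr_eq0 -lt0n fact_gt0 pochhammer_neq0// => i _.
apply/eqP => e; apply: nneg; exists i.
by apply/eqP; rewrite -addr_eq0 -nat1r addrA e.
Qed.

Definition jacobi_coef k (a b : C) j : C :=
  pochhammer (a + 1) k / k`!%:R * ((-1) ^+ j * 'C(k, j)%:R)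
  * pochhammer (k%:R + (a + b + 1)) j / pochhammer (a + 1) j.

Lemma jacobiE k (a b z : C) :
  jacobi k a b z = \sum_(j < k.+1) jacobi_coef k a b j * ((1 - z) / 2%:R) ^+ j.
Proof.
rewrite /jacobi -CseriesZl (@Cseries_finite R _ k.+1); last first.
  move=> j kj; rewrite !big_cons !big_nil pochhammer_opp_nat ffact_small//.
  by rewrite mulr0 !mul0r mulr0.
apply: eq_bigr => j _; rewrite !big_cons !big_nil !mulr1 pochhammer_opp_nat.
rewrite /jacobi_coef -bin_ffact natrM !addrA.
have k0 : (k`!%:R : C) != 0 by rewrite pnatr_eq0 -lt0n fact_gt0.
have j0 : (j`!%:R : C) != 0 by rewrite pnatr_eq0 -lt0n fact_gt0.
move: ((pochhammer (a + 1) j)^-1) => q.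
by field; rewrite ?k0 ?j0.
Qed.

(** Away from the exceptional parameters the Pochhammer symbols in
    alpha + beta + 1 combine by duplication and concatenation, so one formula
    covers every alpha. *)
Lemma alpha_factorE k (alpha : C) (beta gamma : R) z :
  alpha_factor k alpha beta gamma z
  = 4%:R ^- k * Cseries (fun n =>
        pochhammer (alpha - gamma%:C) n * pochhammer (alpha + beta%:C + k%:R + n%:R + 1) k
        / pochhammer (gamma%:C + beta%:C + 2%:R * k%:R + 2%:R) n
        * rGamma (alpha + k%:R + n%:R + 1) * (z ^+ n / n`!%:R)).
Proof.
rewrite /alpha_factor; case: asboolP => // h.
rewrite -!CseriesZl; congr Cseries; apply/funext => n.
have h1 m : pochhammer (alpha + 1) m != 0.
  apply: pochhammer_neq0 => i _; apply/eqP => e; apply: h; left; exists i.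
  by apply/eqP; rewrite -addr_eq0 e.
have h2 m : pochhammer (alpha + beta%:C + 1) m != 0.
  apply: pochhammer_neq0 => i _; apply/eqP => e; apply: h; right; exists i.
  by apply/eqP; rewrite -addr_eq0 e.
rewrite !big_cons !big_nil !mulr1 /Gamma.
have := h1 (k + n)%N; have := h2 (k + n)%N; rewrite !pochhammerD !mulf_eq0 !negb_or.
move=> /andP[q1 q2] /andP[q3 q4].
have e1 := pochhammer_duplication (alpha + beta%:C + 1) k.
rewrite (_ : alpha + beta%:C + 1 + 1 = alpha + beta%:C + 2%:R) in e1; last by ring.
rewrite [X in X / _ * _]e1 pochhammerD.
have e2 : pochhammer (alpha + beta%:C + 1 + k%:R) k
     * pochhammer (2%:R * k%:R + alpha + beta%:C + 1) n
   = pochhammer (alpha + beta%:C + k%:R + 1) n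
     * pochhammer (alpha + beta%:C + k%:R + n%:R + 1) k.
  have -> : alpha + beta%:C + k%:R + 1 = alpha + beta%:C + 1 + k%:R by ring.
  have -> : 2%:R * k%:R + alpha + beta%:C + 1 = alpha + beta%:C + 1 + k%:R + k%:R.
    ring.
  have -> : alpha + beta%:C + k%:R + n%:R + 1 = alpha + beta%:C + 1 + k%:R + n%:R.
    ring.
  by rewrite -!pochhammerD addnC.
have e3 := rGamma_pochhammer (alpha + 1 + k%:R) n.
rewrite (_ : alpha + 1 + k%:R + n%:R = alpha + k%:R + n%:R + 1) in e3; last by ring.
rewrite (_ : alpha + k%:R + 1 = alpha + 1 + k%:R); last by ring.
rewrite (invfM (rGamma (alpha + 1 + k%:R))^-1) invrK -e3.
rewrite (_ : alpha + beta%:C + 1 + k%:R = alpha + beta%:C + k%:R + 1) in q2 e2 *; last by ring.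
move: (pochhammer (alpha + beta%:C + k%:R + n%:R + 1) k) e2 => X e2.
have -> : X = pochhammer (alpha + beta%:C + k%:R + 1) k
     * pochhammer (2%:R * k%:R + alpha + beta%:C + 1) n
     / pochhammer (alpha + beta%:C + k%:R + 1) n by rewrite e2 mulrC mulKf.
rewrite !(invfM (pochhammer (alpha + beta%:C + k%:R + 1) n)).
rewrite !(invfM (pochhammer (gamma%:C + beta%:C + 2%:R * k%:R + 2%:R) n)).
move: ((pochhammer (gamma%:C + beta%:C + 2%:R * k%:R + 2%:R) n)^-1) => Y.
have n0 : (n`!%:R : C) != 0 by rewrite pnatr_eq0 -lt0n fact_gt0.
move: ((4%:R ^- k) : C) => W.
by field; rewrite q1 q2 q4 n0.
Qed.

End SpecialFunctions.

(** * Moments of the expansion *)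
Section BesselJacobiIntegral.
Context {R : realType}.
Local Notation C := R[i].
Local Notation normc := ComplexField.Normc.normc.
Local Notation D := (`]-1, 1[%classic : set R).

Lemma rGamma_real_neq0 (a : R) : 0 < a -> rGamma a%:C != 0.
Proof. by move=> a0; rewrite rGamma_real// real_complex_eq0 gt_eqF// rGammaR_gt0. Qed.

Lemma beta_int_complex (a b : R) : 0 < a -> 0 < b ->
  (beta_int a b)%:C = 2%:R * rGamma (a + b)%:C / (rGamma a%:C * rGamma b%:C).
Proof.
move=> a0 b0; rewrite !rGamma_real ?addr_gt0//.
have ra := rGammaR_gt0 a0; have rb := rGammaR_gt0 b0.
rewrite -(rmorph_nat (real_complex R)) -!rmorphM -fmorphV -rmorphM; congr _%:C.
by rewrite -beta_int_rGamma//; field; rewrite !gt_eqF.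
Qed.

Variables (k : nat) (alpha : C) (beta gamma : R).
Hypotheses (hbeta : -1 < beta) (hgamma : -1 < gamma).
Local Notation be := (beta%:C).
Local Notation ga := (gamma%:C).

(** Coefficient of rho ^+ (s + t) u ^+ (s + j) v ^+ t in the product of the two
    Bessel series and the Jacobi polynomial, with u = (1 - x) / 2 and
    v = (1 + x) / 2. *)
Definition expansion_coef (s t j : nat) : C :=
  bessel_coef alpha s * (-1) ^+ s * bessel_coef be t * jacobi_coef k ga be j.

Definition expansion_weight (s t j : nat) : R -> R :=
  beta_weight (gamma + 1 + (s + j)%:R) (beta + 1 + t%:R).

Definition expansion_moment N : C :=
  \sum_(s < N.+1) \sum_(j < k.+1) expansion_coef s (N - s) j
    * (beta_int (gamma + 1 + (s + j)%:R) (beta + 1 + (N - s)%:R))%:C.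

Let beta1 n : 0 < beta + 1 + n%:R.
Proof. by rewrite ltr_wpDr ?ler0n// -ltrBlDr sub0r. Qed.

Let gamma1 n : 0 < gamma + 1 + n%:R.
Proof. by rewrite ltr_wpDr ?ler0n// -ltrBlDr sub0r. Qed.

(** The beta integral cancels the 1/Gamma factor of the second Bessel series;
    the other Gamma factors are brought to arguments independent of s and j,
    which leaves a Chu-Vandermonde term in s inside a Saalschutz term in j. *)
Lemma expansion_term_beta_int N s j : (s <= N)%N -> (j <= k)%N ->
  expansion_coef s (N - s) j
    * (beta_int (gamma + 1 + (s + j)%:R) (beta + 1 + (N - s)%:R))%:C
  = 2%:R / (rGamma (ga + 1 + k%:R) * k`!%:R * N`!%:R)
    * rGamma (alpha + N%:R + 1) * rGamma (ga + be + 2%:R + N%:R + k%:R)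
    * ((-1) ^+ j * 'C(k, j)%:R
       * (pochhammer (k%:R + (ga + be + 1)) j
          * pochhammer (ga + be + 1 + N%:R + 1 + j%:R) (k - j)))
    * ((-1) ^+ s * 'C(N, s)%:R
       * (pochhammer (ga + 1 + j%:R) s * pochhammer (alpha + 1 + s%:R) (N - s))).
Proof.
move=> sN jk; rewrite beta_int_complex//.
have gE n : (gamma + 1 + n%:R)%:C = ga + 1 + n%:R.
  by rewrite !rmorphD /= rmorph_nat.
have bE n : (beta + 1 + n%:R)%:C = be + 1 + n%:R.
  by rewrite !rmorphD /= rmorph_nat.
have G0 n : rGamma (ga + 1 + n%:R) != 0 by rewrite -gE rGamma_real_neq0 ?gamma1.
have B0 n : rGamma (be + 1 + n%:R) != 0 by rewrite -bE rGamma_real_neq0 ?beta1.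
have p0 n : pochhammer (ga + 1) n != 0.
  apply: pochhammer_neq0 => i _.
  by rewrite -gE real_complex_eq0 gt_eqF.
rewrite rmorphD/= gE bE /expansion_coef /bessel_coef /jacobi_coef.
rewrite (_ : ga + 1 + (s + j)%:R + (be + 1 + (N - s)%:R)
  = ga + be + 1 + N%:R + 1 + j%:R); last first.
  by rewrite natrD natrB//; ring.
have E1 := rGamma_pochhammer (alpha + 1 + s%:R) (N - s).
rewrite (_ : alpha + 1 + s%:R + (N - s)%:R = alpha + N%:R + 1) in E1; last first.
  by rewrite natrB//; ring.
rewrite (_ : alpha + s%:R + 1 = alpha + 1 + s%:R); last by ring.
rewrite -E1.
have E4 := rGamma_pochhammer (ga + be + 1 + N%:R + 1 + j%:R) (k - j).
rewrite (_ : ga + be + 1 + N%:R + 1 + j%:R + (k - j)%:R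
  = ga + be + 2%:R + N%:R + k%:R) in E4; last by rewrite natrB//; ring.
rewrite -E4.
rewrite (_ : be + (N - s)%:R + 1 = be + 1 + (N - s)%:R); last by ring.
have E2 : pochhammer (ga + 1) k
  = pochhammer (ga + 1) j * pochhammer (ga + 1 + j%:R) s
    * rGamma (ga + 1 + (s + j)%:R) / rGamma (ga + 1 + k%:R).
  apply: (mulIf (G0 k)); rewrite divfK//.
  by rewrite -pochhammerD [(s + j)%N]addnC !rGamma_pochhammer.
have f0 n : (n`!%:R : C) != 0 by rewrite pnatr_eq0 -lt0n fact_gt0.
have E5 : 'C(N, s)%:R = N`!%:R / (s`!%:R * (N - s)`!%:R) :> C.
  by rewrite -(bin_fact sN) !natrM mulfK// mulf_neq0.
rewrite E2 E5.
move: (f0 s) (f0 (N - s)%N) (f0 k) (f0 N) (G0 k) (G0 (s + j)%N) (B0 (N - s)%N) (p0 j).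
move: (rGamma (ga + 1 + k%:R)) (rGamma (ga + 1 + (s + j)%:R)) (rGamma (be + 1 + _)) => r1 r2 r3.
move: (rGamma (alpha + N%:R + 1)) (rGamma (ga + be + 2%:R + N%:R + k%:R)) => r4 r5.
move: (pochhammer (alpha + 1 + s%:R) (N - s)) => q1.
move: (pochhammer (ga + be + 1 + N%:R + 1 + j%:R) (k - j)) => q2.
move: (pochhammer (ga + 1) j) (pochhammer (ga + 1 + j%:R) s) => q3 q4.
move: (pochhammer (k%:R + (ga + be + 1)) j) => q5.
move: (s`!%:R : C) ((N - s)`!%:R : C) (k`!%:R : C) (N`!%:R : C) => F1 F2 F3 F4.
move: ('C(k, j)%:R : C) ((-1) ^+ j : C) ((-1) ^+ s : C) => u1 u2 u3.
move=> h1 h2 h3 h4 h5 h6 h7 h8.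
by field; rewrite h1 h2 h3 h4 h5 h6 h7 h8.
Qed.

Lemma expansion_momentE N :
  expansion_moment N
  = 2%:R / (rGamma (ga + 1 + k%:R) * k`!%:R * N`!%:R)
    * rGamma (alpha + N%:R + 1) * rGamma (ga + be + 2%:R + N%:R + k%:R)
    * ((N ^_ k)%:R * pochhammer (alpha - ga) (N - k)
       * pochhammer (alpha + be + N%:R + 1) k).
Proof.
rewrite /expansion_moment exchange_big/=.
transitivity (2%:R / (rGamma (ga + 1 + k%:R) * k`!%:R * N`!%:R)
    * rGamma (alpha + N%:R + 1) * rGamma (ga + be + 2%:R + N%:R + k%:R)
    * saalschutz_sum k N (ga + be + 1) (alpha - ga)).
  rewrite /saalschutz_sum mulr_sumr; apply: eq_bigr => j _.
  under eq_bigr => s _ do rewrite expansion_term_beta_int -1?ltnS//.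
  rewrite -mulr_sumr chu_vandermonde.
  rewrite (_ : alpha + 1 - (ga + 1 + j%:R) = alpha - ga - j%:R); last by ring.
  by ring.
rewrite pfaff_saalschutz; last first.
  move=> i; have -> : ga + be + 1 + i.+1%:R = ((gamma + 1) + (beta + 1) + i%:R)%:C.
    by rewrite !rmorphD/= rmorph_nat -natr1 rmorph1; ring.
  by rewrite real_complex_eq0 gt_eqF// ltr_wpDr ?ler0n// -[gamma + 1]addr0 -[beta + 1]addr0 addr_gt0 ?(gamma1 0) ?(beta1 0).
congr (_ * (_ * pochhammer _ _)); ring.
Qed.

End BesselJacobiIntegral.

(** * The integrand as a weighted product of power series *)
Section Expansion.
Context {R : realType}.
Local Notation C := R[i].
Local Notation normc := ComplexField.Normc.normc.
Local Notation D := (`]-1, 1[%classic : set R).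
Implicit Types (x r : R) (rho nu : C).

Lemma Cpow_invr r (z : C) : 0 < r -> Cpow (r^-1)%:C z = Cpow r%:C (- z).
Proof.
move=> r0; rewrite /Cpow !real_complex_eq0 invr_eq0 gt_eqF// !Clog_real ?invr_gt0//.
by rewrite lnV// rmorphN mulrN mulNr.
Qed.

Lemma nat_complex n : (n%:R : R)%:C = n%:R :> C.
Proof. exact: rmorph_nat. Qed.

Lemma Cpow_half_sqrtc r rho nu : 0 < r -> rho != 0 ->
  Cpow (sqrtc (2%:R * r%:C * rho) / 2%:R) nu
  = Cpow 2%:R (- (nu / 2%:R)) * Cpow r%:C (nu / 2%:R) * Cpow rho (nu / 2%:R).
Proof.
move=> r0 rho0; have n20 : (2%:R : C) != 0 by rewrite pnatr_eq0.
have rr0 : r%:C * rho != 0 by rewrite mulf_neq0// real_complex_eq0 gt_eqF.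
have w0 : 2%:R * r%:C * rho != 0 by rewrite -mulrA mulf_neq0.
have two : 0 < 2%:R :> R by rewrite ltr0n.
rewrite mulrC -[2%:R in X in X * sqrtc _]nat_complex -fmorphV/=.
rewrite CpowMr ?invr_gt0 ?sqrtc_eq0// Cpow_invr// Cpow_sqrtc//.
have -> : 2%:R * r%:C * rho = (2%:R : R)%:C * (r%:C * rho).
  by rewrite nat_complex mulrA.
rewrite CpowMr// CpowMr//.
rewrite mulrA -CpowD ?real_complex_eq0 ?pnatr_eq0// nat_complex !mulrA.
by congr (Cpow _ _ * _ * _); field.
Qed.

Lemma beta_weightM (a b x : R) m n : D x ->
  beta_weight (a + m%:R) (b + n%:R) x
  = beta_weight a b x * (((1 - x) / 2%:R) ^+ m * ((1 + x) / 2%:R) ^+ n).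
Proof.
move=> Dx; have [/andP[u0 _] /andP[v0 _]] := half_itv Dx.
have hD (t p : R) i : 0 < t -> t `^ (p + i%:R - 1) = t `^ (p - 1) * t ^+ i.
  move=> t0; rewrite -powR_mulrn ?ltW// -powRD; first by rewrite addrAC.
  by rewrite (gt_eqF t0) implybT.
by rewrite /beta_weight !hD//; ring.
Qed.

Lemma sqr_half_sqrtc r rho sgn :
  sgn * (sqrtc (2%:R * r%:C * rho) ^+ 2 / 4%:R) = sgn * (rho * (r / 2%:R)%:C).
Proof. by rewrite sqr_sqrtc fmorph_div/= nat_complex; field. Qed.

Variables (k : nat) (alpha : C) (beta gamma : R).
Local Notation be := (beta%:C).
Local Notation ga := (gamma%:C).

(** The factors -1 and 1 in these two series are the signs that distinguish
    J from I, in the shape in which besselE delivers them. *)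
Definition bessel_seriesJ rho x s : C :=
  bessel_coef alpha s * (- 1 * (rho * ((1 - x) / 2%:R)%:C)) ^+ s.

Definition bessel_seriesI rho x t : C :=
  bessel_coef be t * (1 * (rho * ((1 + x) / 2%:R)%:C)) ^+ t.

Definition jacobi_poly x : C :=
  \sum_(j < k.+1) jacobi_coef k ga be j * ((1 - x) / 2%:R)%:C ^+ j.

(** The powers of 1 - x and 1 + x hidden in the Bessel functions turn the
    integrand into a Jacobi weight times entire functions of rho. *)
Lemma bessel_jacobi_integrandE rho x : rho != 0 -> D x ->
  bessel_jacobi_integrand k alpha beta gamma rho x
  = Cpow rho (alpha / 2%:R + be / 2%:R) * Cpow 2%:R (ga + be / 2%:R - alpha / 2%:R)
    * ((beta_weight (gamma + 1) (beta + 1) x)%:C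
       * (Cseries (bessel_seriesJ rho x) * Cseries (bessel_seriesI rho x))
       * jacobi_poly x).
Proof.
move=> rho0 Dx; have [/andP[u0 _] /andP[v0 _]] := half_itv Dx.
have n20 : (2%:R : C) != 0 by rewrite pnatr_eq0.
have two : 0 < 2%:R :> R by rewrite ltr0n.
have xm : 0 < 1 - x by move: u0; rewrite pmulr_lgt0 ?invr_gt0.
have xp : 0 < 1 + x by move: v0; rewrite pmulr_lgt0 ?invr_gt0.
have z0 r : 0 < r -> sqrtc (2%:R * r%:C * rho) != 0.
  by move=> r0; rewrite sqrtc_eq0 !mulf_neq0// real_complex_eq0 gt_eqF.
rewrite /bessel_jacobi_integrand /besselJ /besselI !besselE ?z0//.
rewrite !sqr_half_sqrtc !Cpow_half_sqrtc// jacobiE.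
have -> : \sum_(j < k.+1) jacobi_coef k ga be j * ((1 - x%:C) / 2%:R) ^+ j
    = jacobi_poly x.
  by apply: eq_bigr => j _; rewrite fmorph_div rmorphB/= nat_complex.
rewrite -/(bessel_seriesJ rho x) -/(bessel_seriesI rho x).
have r0 r : 0 < r -> r%:C != 0 by move=> ?; rewrite real_complex_eq0 gt_eqF.
have e1 : Cpow (1 - x)%:C (ga - alpha / 2%:R) * Cpow (1 - x)%:C (alpha / 2%:R)
    = Cpow 2%:R ga * (((1 - x) / 2%:R) `^ gamma)%:C.
  rewrite -CpowD ?r0// subrK -[X in Cpow X%:C ga](@divfK _ 2%:R) ?gt_eqF//.
  by rewrite mulrC rmorphM CpowMr ?r0// nat_complex Cpow_real.
have e2 : Cpow (1 + x)%:C (be / 2%:R) * Cpow (1 + x)%:C (be / 2%:R)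
    = Cpow 2%:R be * (((1 + x) / 2%:R) `^ beta)%:C.
  rewrite -CpowD ?r0// -splitr -[X in Cpow X%:C be](@divfK _ 2%:R) ?gt_eqF//.
  by rewrite mulrC rmorphM CpowMr ?r0// nat_complex Cpow_real.
have e3 : Cpow 2%:R (ga + be / 2%:R - alpha / 2%:R)
  = Cpow 2%:R ga * Cpow 2%:R be * Cpow 2%:R (- (alpha / 2%:R)) * Cpow 2%:R (- (be / 2%:R)).
  by rewrite -!CpowD//; congr Cpow; field.
rewrite e3 (CpowD _ _ rho0) /beta_weight !addrK rmorphM/=.
move: (Cseries _) (Cseries _) (jacobi_poly x) => X Y Z.
transitivity ((Cpow (1 - x)%:C (ga - alpha / 2%:R) * Cpow (1 - x)%:C (alpha / 2%:R))
  * (Cpow (1 + x)%:C (be / 2%:R) * Cpow (1 + x)%:C (be / 2%:R))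
  * Cpow 2%:R (- (alpha / 2%:R)) * Cpow 2%:R (- (be / 2%:R))
  * Cpow rho (alpha / 2%:R) * Cpow rho (be / 2%:R) * X * Y * Z).
  by ring.
by rewrite e1 e2; ring.
Qed.

End Expansion.

(** * Power series near the origin *)
Section PowerSeriesAtZero.
Context {R : realType}.
Local Notation C := R[i].
Local Notation normc := ComplexField.Normc.normc.

Lemma cauchy_partial_bound (a b : nat -> C) n :
  normc (series (fun n => \sum_(i < n.+1) a i * b (n - i)%N) n)
  <= series (fun n => normc (a n)) n * series (fun n => normc (b n)) n.
Proof.
have -> := sum_antidiagonal (fun i j => a i * b j) n : series _ n = _.
rewrite (le_trans (normc_sum _ _))// {1}/series /= mulr_suml.
apply: ler_sum => i _; rewrite (le_trans (normc_sum _ _))// {1}/series /= mulr_sumr.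
rewrite [leRHS](big_cat_nat (leq0n (n - i)) (leq_subr i n))/=.
rewrite ler_wpDr ?sumr_ge0//; first by move=> j _; rewrite mulr_ge0 ?normc_ge0.
by apply: ler_sum => j _; rewrite ComplexField.Normc.normcM.
Qed.

Lemma cvgC_bounded (u : nat -> C) (l : C) :
  (u : nat -> C^o) @ \oo --> (l : C^o) -> exists B : R, forall n, normc (u n) <= B.
Proof.
move=> /cvgC_normcP/(_ 1 ltr01) [N _ hN].
exists (\sum_(i < N) normc (u i) + (normc l + 1)) => n.
have s0 : 0 <= \sum_(i < N) normc (u i) by apply: sumr_ge0 => i _; exact: normc_ge0.
have [nN|Nn] := ltnP n N.
  rewrite (bigD1 (Ordinal nN))//= -addrA lerDl addr_ge0 ?sumr_ge0//.
  - by move=> i _; exact: normc_ge0.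
  - by rewrite addr_ge0 ?normc_ge0.
rewrite ler_wpDl// (_ : u n = l + - (l - u n)); last by ring.
by rewrite (le_trans (normcD _ _))// lerD2l normcN ltW// hN.
Qed.

Lemma geometric_sum_le2 (q : R) n : 0 <= q <= 2%:R^-1 ->
  \sum_(0 <= i < n) q ^+ i <= 2%:R.
Proof.
move=> /andP[q0 q1]; elim: n => [|n IH]; first by rewrite big_nil.
rewrite big_nat_recl// expr0.
under eq_bigr do rewrite exprS.
rewrite -mulr_sumr.
have : q * \sum_(0 <= i < n) q ^+ i <= 2%:R^-1 * 2%:R.
  by apply: ler_pM => //; apply: sumr_ge0 => i _; exact: exprn_ge0.
rewrite mulVf ?pnatr_eq0//; lra.
Qed.

Lemma near_dnbhs0 (d : R) : 0 < d ->
  \forall z \near (0 : C^o)^', z != 0 /\ normc z < d.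
Proof.
move=> d0.
have h1 : \forall z \near (0 : C^o)^', z != 0 by exact: nbhs_dnbhs_neq.
have : (fun z : C => z : C^o) @ (0 : C^o)^' --> (0 : C^o) by exact: nbhs_dnbhs.
move=> /cvgC_normcP/(_ d d0) h2.
by apply: filterS2 h1 h2 => z ->; rewrite sub0r normcN.
Qed.

Lemma cvg_expr_dnbhs0 n :
  (fun z : C => z ^+ n : C^o) @ (0 : C^o)^' --> ((0 : C) ^+ n : C^o).
Proof.
have cid : (fun z : C => z : C^o) @ (0 : C^o)^' --> (0 : C^o) by exact: nbhs_dnbhs.
elim: n => [|n IH]; first by under eq_fun do rewrite expr0; exact: cvgC_cst.
by under eq_fun do rewrite exprS; rewrite exprS; refine (cvgC_M cid IH).
Qed.

(** Convergence at one nonzero point bounds the coefficients geometrically,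
    so the sum differs from its constant term by O(z). *)
Lemma power_series_cvg0 (c : nat -> C) :
  (forall z : C, z != 0 -> normc z < 1 ->
     cvg ((series (fun n => c n * z ^+ n) : nat -> C^o) @ \oo)) ->
  (Cseries (fun n => c n * z ^+ n) : C^o) @[z --> (0 : C^o)^'] --> (c 0%N : C^o).
Proof.
move=> hc.
(* Any nonzero point of the disc would do; 1/2 bounds the coefficients by
   a multiple of 2 ^+ n. *)
pose h : C := (2%:R^-1)%:C.
have nh : normc h = 2%:R^-1 by rewrite normc_real ger0_norm// invr_ge0.
have h0 : h != 0 by rewrite real_complex_eq0 invr_eq0 pnatr_eq0.
have h1 : normc h < 1 by rewrite nh invf_lt1// ltr1n.
have [B hB] : exists B : R, forall n, normc (c n * h ^+ n) <= B.
  exact: (cvgC_bounded (cvg_series_cvg_0 (hc h h0 h1))).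
have B0 : 0 <= B by rewrite (le_trans (normc_ge0 _) (hB 0%N)).
have cB n : normc (c n) <= B * 2%:R ^+ n.
  have := hB n; rewrite ComplexField.Normc.normcM normcX nh exprVn.
  by rewrite ler_pdivrMr ?exprn_gt0// ltr0n.
apply/cvgC_normcP => e e0.
have d0 : 0 < Num.min (4%:R^-1) (e / (4%:R * (B + 1))).
  by rewrite lt_min invr_gt0 ltr0n/= divr_gt0// mulr_gt0 ?ltr0n// ltr_wpDl.
apply: filterS (near_dnbhs0 d0) => z [z0]; rewrite lt_min => /andP[z1 z2].
have z3 : normc z < 1 by rewrite (lt_trans z1)// invf_lt1 ?ltr0n// ltr1n.
have /cvg_ex [l hl] := hc z z0 z3.
rewrite (Cseries_cvg hl) -normcN opprB.
have q01 : 0 <= 2%:R * normc z <= 2%:R^-1.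
  by rewrite mulr_ge0 ?normc_ge0//=; move: z1; lra.
have key n : normc (series (fun n => c n * z ^+ n) n.+1 - c 0%N) <= 4%:R * B * normc z.
  rewrite /series /= big_nat_recl// expr0 mulr1 addrC addKr.
  rewrite (le_trans (normc_sum _ _))//.
  have -> : 4%:R * B * normc z = B * (2%:R * normc z) * 2%:R by ring.
  apply: (@le_trans _ _ (B * (2%:R * normc z) * \sum_(0 <= i < n) (2%:R * normc z) ^+ i)); last first.
    rewrite ler_wpM2l ?mulr_ge0 ?normc_ge0//.
    exact: geometric_sum_le2.
  rewrite mulr_sumr; apply: ler_sum => i _.
  rewrite ComplexField.Normc.normcM normcX -mulrA -exprS exprMn mulrA.
  by rewrite ler_wpM2r ?exprn_ge0 ?normc_ge0// cB.
have : normc (l - c 0%N) <= 4%:R * B * normc z.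
  apply/ler_addgt0Pr => d d1.
  have /cvgC_normcP/(_ d d1) [N _ /(_ N.+1 (leqnSn N)) hN] := hl.
  rewrite (_ : l - c 0%N = (l - series (fun n => c n * z ^+ n) N.+1)
     + (series (fun n => c n * z ^+ n) N.+1 - c 0%N)); last by ring.
  by rewrite (le_trans (normcD _ _))// addrC lerD// ltW.
move=> le; apply: (le_lt_trans le).
apply: (@le_lt_trans _ _ (4%:R * (B + 1) * normc z)).
  by rewrite ler_wpM2r ?normc_ge0// ler_wpM2l// lerDl.
by move: z2; rewrite ltr_pdivlMr ?mulr_gt0 ?ltr0n ?ltr_wpDl// mulrC.
Qed.

End PowerSeriesAtZero.

(** * Termwise integration and the closed form *)
Section Main.
Context {R : realType}.
Local Notation C := R[i].
Local Notation normc := ComplexField.Normc.normc.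
Local Notation mu := (@lebesgue_measure R).
Local Notation D := (`]-1, 1[%classic : set R).
Variables (k : nat) (alpha : C) (beta gamma : R).
Hypotheses (hbeta : -1 < beta) (hgamma : -1 < gamma).
Local Notation be := (beta%:C).
Local Notation ga := (gamma%:C).
Implicit Types (x : R) (rho : C).

Let beta1 n : 0 < beta + 1 + n%:R.
Proof. by rewrite ltr_wpDr ?ler0n// -ltrBlDr sub0r. Qed.

Let gamma1 n : 0 < gamma + 1 + n%:R.
Proof. by rewrite ltr_wpDr ?ler0n// -ltrBlDr sub0r. Qed.

Let mD : measurable D. Proof. exact: measurable_itv. Qed.

Let weight x : C := (beta_weight (gamma + 1) (beta + 1) x)%:C.

Definition expansion_summand N s j x : C :=
  expansion_coef k alpha beta gamma s (N - s) j
  * (expansion_weight beta gamma s (N - s) j x)%:C.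

Definition expansion_summand2 N s x : C := \sum_(j < k.+1) expansion_summand N s j x.

Definition expansion_summand1 N x : C := \sum_(s < N.+1) expansion_summand2 N s x.

Definition partial_integrand rho M x : C :=
  \sum_(N < M) rho ^+ N * expansion_summand1 N x.

Let integrable_weight N s j :
  Cintegrable D (fun x => (expansion_weight beta gamma s (N - s) j x)%:C).
Proof. by apply: Cintegrable_real => //; exact: integrable_beta_weight. Qed.

Let integrable_summand N s j : Cintegrable D (expansion_summand N s j).
Proof. by apply: CintegrableZl => //; exact: integrable_weight. Qed.

Let integrable_summand2 N s : Cintegrable D (expansion_summand2 N s).
Proof. exact: (Cintegrable_sum mD _ (integrable_summand N s)). Qed.

Let integrable_summand1 N : Cintegrable D (expansion_summand1 N).
Proof. exact: (Cintegrable_sum mD _ (integrable_summand2 N)). Qed.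

Let integrable_scaled rho N : Cintegrable D (fun x => rho ^+ N * expansion_summand1 N x).
Proof. exact: CintegrableZl. Qed.

Lemma Cintegrable_partial rho M : Cintegrable D (partial_integrand rho M).
Proof. exact: (Cintegrable_sum mD _ (integrable_scaled rho)). Qed.

Lemma Cintegral_partial rho M :
  Cintegral D (partial_integrand rho M)
  = \sum_(N < M) rho ^+ N * expansion_moment k alpha beta gamma N.
Proof.
rewrite (Cintegral_sum mD _ (integrable_scaled rho)).
apply: eq_bigr => N _; rewrite (CintegralZl mD _ (integrable_summand1 N)).
rewrite (Cintegral_sum mD _ (integrable_summand2 N)); congr (_ * _).
apply: eq_bigr => s _; rewrite (Cintegral_sum mD _ (integrable_summand N s)).
apply: eq_bigr => j _; rewrite (CintegralZl mD _ (integrable_weight N s j)).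
by rewrite Cintegral_real.
Qed.

Lemma partial_integrandE rho M x : D x ->
  partial_integrand rho M x
  = weight x
    * series (fun N => \sum_(s < N.+1) bessel_seriesJ alpha rho x s
                       * bessel_seriesI beta rho x (N - s)%N) M
    * jacobi_poly k beta gamma x.
Proof.
move=> Dx; rewrite /partial_integrand.
rewrite -(big_mkord xpredT (fun N => rho ^+ N * expansion_summand1 N x)).
rewrite /series /= [weight x * _]mulr_sumr mulr_suml; apply: eq_bigr => N _.
rewrite mulr_sumr [weight x * _]mulr_sumr mulr_suml; apply: eq_bigr => s _.
rewrite /expansion_summand2 /jacobi_poly !mulr_sumr; apply: eq_bigr => j _.
rewrite /expansion_summand.
have sN : (s <= N)%N by rewrite -ltnS.
rewrite /expansion_weight beta_weightM// /expansion_coef.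
rewrite /bessel_seriesJ /bessel_seriesI /weight.
move: (bessel_coef alpha s) (bessel_coef be (N - s)%N) (jacobi_coef k ga be j) => a1 a2 a3.
move: (beta_weight _ _ x) ((1 - x) / 2%:R) ((1 + x) / 2%:R) => w u v.
rewrite !rmorphM/= !rmorphXn/= mul1r mulN1r exprD -{1}(subnKC sN) exprD.
rewrite [in RHS]exprNn !exprMn.
by ring.
Qed.

Let normc_half_le1 (t : R) : 0 < t < 1 -> normc t%:C <= 1.
Proof. by move=> /andP[t0 t1]; rewrite normc_real gtr0_norm// ltW. Qed.

Lemma bessel_seriesJ_le rho x s : D x ->
  normc (bessel_seriesJ alpha rho x s) <= normc (bessel_coef alpha s) * normc rho ^+ s.
Proof.
move=> /half_itv[u _]; rewrite /bessel_seriesJ ComplexField.Normc.normcM normcX.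
rewrite ler_wpM2l ?normc_ge0// lerXn2r ?nnegrE ?normc_ge0//.
rewrite mulN1r normcN ComplexField.Normc.normcM -[leRHS]mulr1.
by rewrite ler_wpM2l ?normc_ge0// normc_half_le1.
Qed.

Lemma bessel_seriesI_le rho x s : D x ->
  normc (bessel_seriesI beta rho x s) <= normc (bessel_coef be s) * normc rho ^+ s.
Proof.
move=> /half_itv[_ u]; rewrite /bessel_seriesI ComplexField.Normc.normcM normcX.
rewrite ler_wpM2l ?normc_ge0// lerXn2r ?nnegrE ?normc_ge0//.
rewrite mul1r ComplexField.Normc.normcM -[leRHS]mulr1.
by rewrite ler_wpM2l ?normc_ge0// normc_half_le1.
Qed.

Lemma jacobi_poly_bounded x : D x ->
  normc (jacobi_poly k beta gamma x) <= \sum_(0 <= j < k.+1) normc (jacobi_coef k ga be j).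
Proof.
move=> /half_itv[u _]; rewrite /jacobi_poly.
rewrite -(big_mkord xpredT (fun j => jacobi_coef k ga be j * ((1 - x) / 2%:R)%:C ^+ j)).
rewrite (le_trans (normc_sum _ _))//; apply: ler_sum => j _.
rewrite ComplexField.Normc.normcM normcX -[leRHS]mulr1.
by rewrite ler_wpM2l ?normc_ge0// exprn_ile1 ?normc_ge0// normc_half_le1.
Qed.

Lemma summable_dominated (u : nat -> C) (nu : C) (r : R) : 0 <= r ->
  (forall s, normc (u s) <= normc (bessel_coef nu s) * r ^+ s) ->
  cvgn (series (fun s => normc (u s))).
Proof.
move=> r0 hu; apply: (series_le_cvg _ _ hu (@bessel_coef_summable R nu r r0)) => n.
- exact: normc_ge0.
- by rewrite mulr_ge0 ?normc_ge0 ?exprn_ge0.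
Qed.

Lemma series_le_limit (u v : nat -> R) n : (forall i, 0 <= u i <= v i) ->
  cvgn (series v) -> series u n <= limn (series v).
Proof.
move=> uv cv; have v0 i : 0 <= v i by have /andP[a b] := uv i; exact: le_trans b.
apply: (@le_trans _ _ (series v n)).
  by apply: ler_sum => i _; have /andP[] := uv i.
apply: nondecreasing_cvgn_le => //; apply/nondecreasing_seqP => m.
by rewrite /series /= big_nat_recr//= lerDl.
Qed.

(** Termwise integration of the double power series against the Jacobi weight,
    by dominated convergence. *)
Lemma integral_series rho :
  let F x := weight x * (Cseries (bessel_seriesJ alpha rho x)
                         * Cseries (bessel_seriesI beta rho x))
             * jacobi_poly k beta gamma x in
  Cintegrable D F /\
  (series (fun N => rho ^+ N * expansion_moment k alpha beta gamma N) : nat -> C^o) @ \oo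
    --> (Cintegral D F : C^o).
Proof.
move=> F; set r := normc rho; have r0 : 0 <= r by exact: normc_ge0.
have sJ := @bessel_coef_summable R alpha r r0; have sI := @bessel_coef_summable R be r r0.
set SJ := limn (series (fun n => normc (bessel_coef alpha n) * r ^+ n)).
set SI := limn (series (fun n => normc (bessel_coef be n) * r ^+ n)).
set B := \sum_(0 <= j < k.+1) normc (jacobi_coef k ga be j).
have nJ x : D x -> cvgn (series (fun s => normc (bessel_seriesJ alpha rho x s))).
  by move=> Dx; apply: (summable_dominated r0) => s; exact: bessel_seriesJ_le.
have nI x : D x -> cvgn (series (fun s => normc (bessel_seriesI beta rho x s))).
  by move=> Dx; apply: (summable_dominated r0) => s; exact: bessel_seriesI_le.
have sumJ x : D x -> (series (bessel_seriesJ alpha rho x) : nat -> C^o) @ \oo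
    --> (Cseries (bessel_seriesJ alpha rho x) : C^o).
  by move=> /nJ/normc_cvg_series[l hl]; rewrite (Cseries_cvg hl).
have sumI x : D x -> (series (bessel_seriesI beta rho x) : nat -> C^o) @ \oo
    --> (Cseries (bessel_seriesI beta rho x) : C^o).
  by move=> /nI/normc_cvg_series[l hl]; rewrite (Cseries_cvg hl).
have := @dominated_Cintegral R D mD (partial_integrand rho) F
  (fun x => SJ * SI * B * beta_weight (gamma + 1) (beta + 1) x)
  (Cintegrable_partial rho).
case.
- move=> x Dx.
  have e : \forall M \near \oo, weight x
    * series (fun N => \sum_(s < N.+1) bessel_seriesJ alpha rho x s
                       * bessel_seriesI beta rho x (N - s)%N) M
    * jacobi_poly k beta gamma x = partial_integrand rho M x.
    by exists 0%N => // M _; rewrite partial_integrandE.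
  refine (cvgC_near e _).
  refine (cvgC_M _ (@cvgC_cst R nat \oo _ _)); refine (@cvgC_Ml R nat \oo _ _ _ _ _).
  exact: (cauchy_product (nJ x Dx) (nI x Dx) (sumJ x Dx) (sumI x Dx)).
- apply: integrable_RZl => //; apply: integrable_beta_weight.
    by rewrite -[gamma + 1]addr0; exact: (gamma1 0).
  by rewrite -[beta + 1]addr0; exact: (beta1 0).
- move=> M x Dx; rewrite partial_integrandE// !ComplexField.Normc.normcM.
  rewrite normc_real (ger0_norm (beta_weight_ge0 _ _ _)) -mulrA mulrC.
  rewrite ler_wpM2r ?beta_weight_ge0//.
  rewrite ler_pM ?normc_ge0 ?jacobi_poly_bounded//.
  rewrite (le_trans (cauchy_partial_bound _ _ _))// ler_pM ?sumr_ge0//.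
  + by move=> i _; exact: normc_ge0.
  + by move=> i _; exact: normc_ge0.
  + apply: (series_le_limit M _ sJ) => i.
    by rewrite normc_ge0 bessel_seriesJ_le.
  + apply: (series_le_limit M _ sI) => i.
    by rewrite normc_ge0 bessel_seriesI_le.
move=> iF cF; split => //.
have e : \forall M \near \oo, Cintegral D (partial_integrand rho M)
    = series (fun N => rho ^+ N * expansion_moment k alpha beta gamma N) M.
  by exists 0%N => // M _; rewrite Cintegral_partial /series /= big_mkord.
exact: (cvgC_near e cF).
Qed.

Definition hypergeometric_term rho n : C :=
  pochhammer (alpha - ga) n * pochhammer (alpha + be + k%:R + n%:R + 1) k
  / pochhammer (ga + be + 2%:R * k%:R + 2%:R) n
  * rGamma (alpha + k%:R + n%:R + 1) * (rho ^+ n / n`!%:R).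

Definition hypergeometric_const : C :=
  2%:R / (rGamma (ga + 1 + k%:R) * k`!%:R) * rGamma (ga + be + 2%:R * k%:R + 2%:R).

(** Positivity of gamma + beta + 2 + n keeps the denominators in gamma and beta
    away from 0. *)
Lemma total_gt0 n : 0 < gamma + 1 + (beta + 1) + n%:R :> R.
Proof.
rewrite ltr_wpDr ?ler0n// addr_gt0//.
  by rewrite -[gamma + 1]addr0; exact: (gamma1 0).
by rewrite -[beta + 1]addr0; exact: (beta1 0).
Qed.

Lemma total_complex n : ga + be + 2%:R + n%:R = (gamma + 1 + (beta + 1) + n%:R)%:C.
Proof. by rewrite !rmorphD/= !rmorph1 nat_complex; ring. Qed.

Lemma expansion_moment_small N : (N < k)%N -> expansion_moment k alpha beta gamma N = 0.
Proof.
by move=> Nk; rewrite expansion_momentE// ffact_small// !mul0r mulr0.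
Qed.

Lemma expansion_moment_large rho n :
  rho ^+ (n + k) * expansion_moment k alpha beta gamma (n + k) = hypergeometric_const * rho ^+ k * hypergeometric_term rho n.
Proof.
rewrite expansion_momentE// /hypergeometric_const /hypergeometric_term.
have f0 m : (m`!%:R : C) != 0 by rewrite pnatr_eq0 -lt0n fact_gt0.
have e1 : ((n + k) ^_ k)%:R = (n + k)`!%:R / n`!%:R :> C.
  by rewrite -(ffact_fact (leq_addl n k)) addnK natrM mulfK.
have e2 := rGamma_pochhammer (ga + be + 2%:R * k%:R + 2%:R) n.
have p0 : pochhammer (ga + be + 2%:R * k%:R + 2%:R) n != 0.
  apply: pochhammer_neq0 => i _.
  rewrite (_ : _ + i%:R = ga + be + 2%:R + (k + k + i)%:R); last by rewrite !natrD; ring.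
  by rewrite total_complex real_complex_eq0 gt_eqF// total_gt0.
rewrite -e2 (_ : ga + be + 2%:R + (n + k)%:R + k%:R
   = ga + be + 2%:R * k%:R + 2%:R + n%:R); last by rewrite natrD; ring.
rewrite (_ : alpha + (n + k)%:R + 1 = alpha + k%:R + n%:R + 1); last by rewrite natrD; ring.
rewrite (_ : alpha + be + (n + k)%:R + 1 = alpha + be + k%:R + n%:R + 1); last first.
  by rewrite natrD; ring.
have g0 : rGamma (ga + 1 + k%:R) != 0.
  have -> : ga + 1 + k%:R = (gamma + 1 + k%:R)%:C.
    by rewrite !rmorphD/= rmorph1 nat_complex.
  exact: rGamma_real_neq0.
rewrite e1 addnK exprD.
move: (f0 n) (f0 k) (f0 (n + k)%N) p0 g0.
move: (rGamma (ga + 1 + _)) (rGamma (alpha + _ + _ + _)) (rGamma (_ + n%:R)) => r1 r2 r3.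
move: (pochhammer (ga + be + 2%:R * k%:R + 2%:R) n) (pochhammer (alpha - ga) n) => q1 q2.
move: (pochhammer (alpha + be + k%:R + n%:R + 1) k) => q3.
move: (n`!%:R : C) (k`!%:R : C) ((n + k)`!%:R : C) => F1 F2 F3.
by move=> h1 h2 h3 h4 h5; field; rewrite ?h1 ?h2 ?h3 ?h4 ?h5.
Qed.

(** Used to recover convergence of the hypergeometric series from that of the
    integrated expansion. *)
Lemma hypergeometric_const_neq0 : hypergeometric_const != 0.
Proof.
have k0 : (k`!%:R : C) != 0 by rewrite pnatr_eq0 -lt0n fact_gt0.
have h0 : rGamma (ga + 1 + k%:R) != 0.
  have -> : ga + 1 + k%:R = (gamma + 1 + k%:R)%:C.
    by rewrite !rmorphD/= rmorph1 nat_complex.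
  exact: rGamma_real_neq0.
have g0 : rGamma (ga + be + 2%:R * k%:R + 2%:R) != 0.
  rewrite (_ : _ + 2%:R = ga + be + 2%:R + (k + k)%:R); last by rewrite natrD; ring.
  by rewrite total_complex rGamma_real_neq0// total_gt0.
rewrite /hypergeometric_const; apply: mulf_neq0 => //.
by apply: mulf_neq0; rewrite ?pnatr_eq0// invr_eq0; exact: mulf_neq0.
Qed.

Definition prefactor rho : C :=
  Cpow rho (alpha / 2%:R + be / 2%:R) * Cpow 2%:R (ga + be / 2%:R - alpha / 2%:R).

Lemma bessel_jacobi_integral_series rho : rho != 0 ->
  Cintegrable D (bessel_jacobi_integrand k alpha beta gamma rho) /\
  (series (fun n => prefactor rho * (hypergeometric_const * rho ^+ k * hypergeometric_term rho n))
    : nat -> C^o) @ \oo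
    --> (bessel_jacobi_integral k alpha beta gamma rho : C^o).
Proof.
move=> rho0; have [iF cF] := integral_series rho.
set F := (fun x => _) in iF cF.
have eF x : D x -> bessel_jacobi_integrand k alpha beta gamma rho x = prefactor rho * F x.
  by move=> Dx; rewrite bessel_jacobi_integrandE.
split; first by apply: (eq_Cintegrable mD eF); exact: CintegrableZl.
rewrite /bessel_jacobi_integral (eq_Cintegral eF).
rewrite (CintegralZl mD (prefactor rho) iF).
have sE n : series (fun N => rho ^+ N * expansion_moment k alpha beta gamma N) (n + k)%N
   = series (fun n => hypergeometric_const * rho ^+ k * hypergeometric_term rho n) n.
  rewrite /series /= (big_cat_nat (leq0n k) (leq_addl n k))/=.
  rewrite big_nat_cond big1 ?add0r; last first.
    by move=> i /andP[/andP[_ ik] _]; rewrite expansion_moment_small// mulr0.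
  rewrite -{1}[k]add0n big_addn addnK.
  by apply: eq_bigr => i _; rewrite expansion_moment_large.
have h : (fun n => prefactor rho * series (fun n => hypergeometric_const * rho ^+ k * hypergeometric_term rho n) n : C^o)
   @ \oo --> (prefactor rho * Cintegral D F : C^o).
  refine (@cvgC_Ml R nat \oo _ _ _ _ _).
  move: cF; rewrite -(cvg_shiftn k) /=.
  by under eq_fun do rewrite sE.
rewrite (_ : series _ = fun n => prefactor rho
  * series (fun n => hypergeometric_const * rho ^+ k * hypergeometric_term rho n) n)//.
by apply/funext => n; rewrite /series /= mulr_sumr.
Qed.

Lemma bessel_jacobi_valueE rho : rho != 0 ->
  bessel_jacobi_value k alpha beta gamma rho
  = prefactor rho * (hypergeometric_const * rho ^+ k * Cseries (hypergeometric_term rho)).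
Proof.
move=> rho0; rewrite /bessel_jacobi_value alpha_factorE -/(hypergeometric_term rho).
have n20 : (2%:R : C) != 0 by rewrite pnatr_eq0.
rewrite [Cpow rho _]CpowD// Cpow_nat//.
rewrite [Cpow 2%:R _]CpowD// Cpow1// /prefactor /hypergeometric_const /Gamma.
have e := pochhammer_duplication (ga + be + 2%:R) k.
rewrite (_ : ga + be + 2%:R + 1 = ga + be + 3%:R) in e; last by ring.
have e2 := rGamma_pochhammer (ga + be + 2%:R) (k + k).
rewrite (_ : ga + be + 2%:R + (k + k)%:R = ga + be + 2%:R * k%:R + 2%:R) in e2; last first.
  by rewrite natrD; ring.
have p0 : pochhammer (ga + be + 2%:R) (k + k) != 0.
  apply: pochhammer_neq0 => i _.
  by rewrite total_complex real_complex_eq0 gt_eqF// total_gt0.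
have g0 : rGamma (ga + be + 2%:R * k%:R + 2%:R) != 0.
  rewrite (_ : _ + 2%:R = ga + be + 2%:R + (k + k)%:R); last by rewrite natrD; ring.
  by rewrite total_complex rGamma_real_neq0// total_gt0.
have h0 : rGamma (ga + 1 + k%:R) != 0.
  have -> : ga + 1 + k%:R = (gamma + 1 + k%:R)%:C.
    by rewrite !rmorphD/= rmorph1 nat_complex.
  exact: rGamma_real_neq0.
rewrite (_ : ga + k%:R + 1 = ga + 1 + k%:R); last by ring.
rewrite -(mulrA (rGamma (ga + be + 2%:R))^-1) e -e2.
have k0 : (k`!%:R : C) != 0 by rewrite pnatr_eq0 -lt0n fact_gt0.
have w0 : (4%:R ^+ k : C) != 0 by rewrite expf_neq0// pnatr_eq0.
move: p0 g0 h0 k0 w0.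
move: (pochhammer _ _) (rGamma (_ + 2%:R)) (rGamma (ga + _ + _)) => q r1 r2.
move: (Cseries _) (4%:R ^+ k : C) (k`!%:R : C) => S W K p0 g0 h0 k0 w0.
by field; rewrite p0 g0 h0 k0 w0.
Qed.

End Main.

Theorem corollary14 (R : realType) (k : nat) (alpha : R[i]) (beta gamma : R)
    (hbeta : -1 < beta) (hgamma : -1 < gamma)
    (hbg : -1 < beta < 0 -> -1 < gamma < 0 -> beta + gamma + 1 <> 0)
    (rho : R[i]) (hrho : `|rho| < 1) :
  let lhs := bessel_jacobi_integral k alpha beta gamma in
  let rhs := bessel_jacobi_value k alpha beta gamma in
  let scale (z : R[i]) : R[i] := Cpow z (alpha / 2%:R + beta%:C / 2%:R) in
  (rho <> 0 ->
     Cintegrable `]-1, 1[ (bessel_jacobi_integrand k alpha beta gamma rho) /\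
     lhs rho = rhs rho) /\
  (rho = 0 ->
     exists l : R[i]^o,
       ((lhs z / scale z : R[i]^o) @[z --> (0 : R[i]^o)^'] --> l) /\
       ((rhs z / scale z : R[i]^o) @[z --> (0 : R[i]^o)^'] --> l)).
Proof.
move=> lhs rhs scale.
have main z : z != 0 -> lhs z = rhs z.
  move=> z0; have [_ /Cseries_cvg h] := bessel_jacobi_integral_series k alpha hbeta hgamma z0.
  by rewrite /rhs bessel_jacobi_valueE// /lhs -h !CseriesZl.
split.
  move=> /eqP rho0; split; last exact: main.
  by have [] := bessel_jacobi_integral_series k alpha hbeta hgamma rho0.
move=> _.
have two0 : (2%:R : R[i]) != 0 by rewrite pnatr_eq0.
set K := Cpow 2%:R (gamma%:C + beta%:C / 2%:R - alpha / 2%:R) : R[i].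
set c1 := hypergeometric_const k beta gamma.
(* The coefficients of the hypergeometric series are its terms at 1. *)
pose t n := hypergeometric_term k alpha beta gamma 1 n.
have tE z n : hypergeometric_term k alpha beta gamma z n = t n * z ^+ n.
  by rewrite /t /hypergeometric_term expr1n mul1r -[RHS]mulrA [_^-1 * z ^+ n]mulrC.
have ratio z : z != 0 -> rhs z / scale z
    = K * c1 * z ^+ k * Cseries (fun n => t n * z ^+ n).
  move=> z0; rewrite /rhs bessel_jacobi_valueE// /scale /prefactor -/K -/c1.
  have -> : hypergeometric_term k alpha beta gamma z = fun n => t n * z ^+ n.
    by apply/funext => n; rewrite tE.
  by field; exact: Cpow_neq0.
have conv (z : R[i]) : z != 0 -> cvg ((series (fun n => t n * z ^+ n) : nat -> R[i]^o) @ \oo).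
  move=> z0; have [_ h] := bessel_jacobi_integral_series k alpha hbeta hgamma z0.
  set P := prefactor alpha beta gamma z * (c1 * z ^+ k).
  have P0 : P != 0.
    have c10 : c1 != 0 by exact: hypergeometric_const_neq0.
    by apply: mulf_neq0; apply: mulf_neq0; rewrite ?Cpow_neq0 ?expf_neq0.
  apply/cvg_ex; exists (P^-1 * lhs z).
  have e : \forall M \near \oo, P^-1 * series (fun n => prefactor alpha beta gamma z
      * (c1 * z ^+ k * hypergeometric_term k alpha beta gamma z n)) M
      = series (fun n => t n * z ^+ n) M.
    exists 0%N => // M _; rewrite /series /= mulr_sumr; apply: eq_bigr => i _.
    by rewrite tE [prefactor _ _ _ _ * _]mulrA mulKf.
  refine (cvgC_near e (@cvgC_Ml R nat \oo _ _ _ P^-1 h)).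
exists (K * c1 * (0 ^+ k) * t 0%N).
have lim : (rhs z / scale z : R[i]^o) @[z --> (0 : R[i]^o)^']
    --> (K * c1 * (0 ^+ k) * t 0%N : R[i]^o).
  have e : \forall z \near (0 : R[i]^o)^',
      K * c1 * z ^+ k * Cseries (fun n => t n * z ^+ n) = rhs z / scale z.
    by apply: filterS (near_dnbhs0 ltr01) => z [z0 _]; rewrite ratio.
  refine (cvgC_near e _); refine (cvgC_M _ _).
    refine (cvgC_Ml _).
    exact: cvg_expr_dnbhs0.
  by apply: power_series_cvg0 => z z0 _; exact: conv.
split => //.
have e : \forall z \near (0 : R[i]^o)^', rhs z / scale z = lhs z / scale z.
  by apply: filterS (near_dnbhs0 ltr01) => z [z0 _]; rewrite main.
exact: (cvgC_near e lim).
Qed.
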